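(* Let $d\ge 3$. For each $\beta$ satisfying $\frac{2}{d-1}\le\beta<\infty$ there exists a constant $C_\beta>0$ (which may depend on $d$ and $\beta$) such that for every integer $N\ge 2$ there is a point set $\mathcal{P}_N\subset[0,1)^d$ with $N$ points such that $$\left\|D_{\mathcal{P}_N}\,\middle|\,\exp(L^\beta)\right\|\le C_\beta\,(\log N)^{(d-1)-\frac{1}{\beta}}.$$
   Context: Discrepancy function: for a point set $\mathcal{P}_N\subset[0,1)^d$ with $N$ points and $x=(x_1,\ldots,x_d)\in[0,1)^d$, $$D_{\mathcal{P}_N}(x)=\sum_{z\in\mathcal{P}_N}\chi_{[0,x)}(z)-N x_1\cdots x_d,$$ where $[0,x)=[0,x_1)\times\cdots\times[0,x_d)$ and $\chi_A$ is the characteristic function of $A$. Exponential Orlicz spaces: let $\psi:[0,\infty)\to[0,\infty)$ be a convex function with $\psi(x)=0$ if and only if $x=0$. For a measurable real-valued function $f$ on $[0,1)^d$ (with Lebesgue measure as probability measure) put $$\left\|f\,\middle|\,L^\psi\right\|=\inf\Big\{K>0:\ \int_{[0,1)^d}\psi(|f(x)|/K)\,dx\le 1\Big\},\qquad \inf\emptyset=\infty.$$ For $\alpha>0$ fix a convex function $\psi_\alpha$ of this kind which equals $e^{x^\alpha}-1$ for all sufficiently large $x$ (depending on $\alpha$); for $\alpha\ge1$ one may take $\psi_\alpha(x)=e^{x^\alpha}-1$ for all $x\ge0$. Then $\exp(L^\alpha)=L^{\psi_\alpha}$, with norm $\|f|\exp(L^\alpha)\|=\|f|L^{\psi_\alpha}\|$.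 (Different choices of $\psi_\alpha$ give equivalent norms; the constant may depend on the fixed choice.) *)

(* Defs.v *)
From HB Require Import structures.
From mathcomp Require Import all_boot all_order all_algebra finmap.
From mathcomp Require Import all_classical all_reals all_analysis.

Set Implicit Arguments.
Unset Strict Implicit.
Unset Printing Implicit Defensive.

Import Order.TTheory GRing.Theory Num.Theory.
Import numFieldNormedType.Exports.

Local Open Scope classical_set_scope.
Local Open Scope ring_scope.

(* The library has binary product measures only, so Lebesgue measure on R^n is
   obtained by iterating the binary product with the one-dimensional one,
   starting from the point mass on the one-point space of empty tuples. *)
Section product_cons.
Context d (T : measurableType d) (R : realType) (n : nat).
Implicit Type p : T * n.-tuple T.

Definition tuple_cons p : n.+1.-tuple T := [tuple of p.1 :: p.2].

Lemma measurable_tuple_cons : measurable_fun setT tuple_cons.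
Proof. by apply: measurable_cons; [exact: measurable_fst|exact: measurable_snd]. Qed.

Variables (mu : {sigma_finite_measure set T -> \bar R})
  (m : {sigma_finite_measure set (n.-tuple T) -> \bar R}).

Definition product_cons : set (n.+1.-tuple T) -> \bar R :=
  pushforward (mu \x m)%E tuple_cons.

Let preimage_measurable A : measurable A -> measurable (tuple_cons @^-1` A).
Proof. by move=> mA; rewrite -[X in measurable X]setTI; exact: measurable_tuple_cons. Qed.

Let product_cons0 : product_cons set0 = 0%E.
Proof. by rewrite /product_cons /pushforward preimage_set0 measure0. Qed.

Let product_cons_ge0 A : (0 <= product_cons A)%E.
Proof. by rewrite /product_cons /pushforward; exact: (@measure_ge0 _ _ _ (mu \x m)%E). Qed.

Let product_cons_sigma_additive : semi_sigma_additive product_cons.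
Proof.
move=> F mF tF mUF; rewrite /product_cons /pushforward preimage_bigcup.
apply: measure_semi_sigma_additive => [k||].
- exact: preimage_measurable.
- apply/trivIsetP => /= i j _ _ ij; rewrite -preimage_setI.
  by move/trivIsetP : tF => /(_ _ _ _ _ ij) ->//; rewrite preimage_set0.
- by rewrite -preimage_bigcup; exact: preimage_measurable.
Qed.

HB.instance Definition _ := isMeasure.Build _ _ _ product_cons
  product_cons0 product_cons_ge0 product_cons_sigma_additive.

Lemma product_consE (A : set T) (B : set (n.-tuple T)) (C : set (n.+1.-tuple T)) :
  measurable A -> measurable B -> tuple_cons @^-1` C = A `*` B ->
  product_cons C = (mu A * m B)%E.
Proof. by move=> mA mB CE; rewrite /product_cons /pushforward CE product_measure1E. Qed.

Let product_cons_sigma_finite : sigma_finite setT product_cons.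
Proof.
have /sigma_finiteP[F [TF ndF Foo]] := sigma_finiteT mu.
have /sigma_finiteP[G [TG ndG Goo]] := sigma_finiteT m.
pose H k := [set t : n.+1.-tuple T | F k (thead t) /\ G k [tuple of behead t]].
have consH k : tuple_cons @^-1` H k = F k `*` G k.
  apply/seteqP; split => -[x t]; rewrite /H /= theadE (_ : [tuple of _] = t) //;
    exact/val_inj.
exists H => [|k].
  apply/seteqP; split => // t _.
  have [i _ Fi] : (\bigcup_k F k) (thead t) by rewrite -TF.
  have [j _ Gj] : (\bigcup_k G k) [tuple of behead t] by rewrite -TG.
  exists (maxn i j) => //; split.
    by move: (thead t) Fi; exact/subsetPset/ndF/leq_maxl.
  by move: [tuple of behead t] Gj; exact/subsetPset/ndG/leq_maxr.
have [mF ?] := Foo k; have [mG ?] := Goo k; split.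
  rewrite /H (_ : mkset _ = (fun t => thead t) @^-1` F k `&`
    (fun t : n.+1.-tuple T => [tuple of behead t]) @^-1` G k) //.
  apply: measurableI; rewrite -[X in measurable X]setTI.
    exact: measurable_tnth.
  exact: measurable_behead.
by rewrite (product_consE mF mG (consH k)) lte_mul_pinfty// ge0_fin_numE.
Qed.

HB.instance Definition _ := @Measure_isSigmaFinite.Build _ _ _ product_cons
  product_cons_sigma_finite.

End product_cons.

Section product_power.
Context d (T : measurableType d) (R : realType).
Variable mu : {sigma_finite_measure set T -> \bar R}.

Fixpoint product_power n : {sigma_finite_measure set (n.-tuple T) -> \bar R} :=
  if n is n'.+1 then product_cons mu (product_power n') else \d_[tuple].

Lemma measurable_tuple_box n (A : 'I_n -> set T) :
  (forall i, measurable (A i)) ->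
  measurable [set t : n.-tuple T | forall i, A i (tnth t i)].
Proof.
move=> mA.
rewrite (_ : mkset _ = \bigcap_(i in [set: 'I_n]) (@tnth n T ^~ i @^-1` A i)); last first.
  by apply/seteqP; split => [t At i _|t At i]; exact: At.
apply: fin_bigcap_measurable => [|i _]; first exact: finite_finset.
by rewrite -[X in measurable X]setTI; exact: measurable_tnth.
Qed.

Lemma product_power_box n (A : 'I_n -> set T) : (forall i, measurable (A i)) ->
  product_power n [set t | forall i, A i (tnth t i)] = (\prod_(i < n) mu (A i))%E.
Proof.
elim: n A => [A _|n IH A mA].
  by rewrite big_ord0 /= diracE mem_set // => -[].
rewrite big_ord_recl -IH => [|i]; last exact: mA.
apply: (@product_consE _ _ _ _ mu (product_power n) (A ord0)
  [set t | forall i, A (lift ord0 i) (tnth t i)]) => //.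
  by apply: (@measurable_tuple_box _ (fun i => A (lift ord0 i))) => i; exact: mA.
apply/seteqP; split => [[x t] /= At|[x t] /= [Ax At] i].
  split => [|i]; first exact: (At ord0).
  by have := At (lift ord0 i); rewrite tnthS.
case: (unliftP ord0 i) => [j ->|->]; last exact: Ax.
by rewrite tnthS; exact: At.
Qed.

End product_power.

Definition lebesgue_tuple {R : realType} (n : nat) :
    {sigma_finite_measure set (n.-tuple (measurableTypeR R)) -> \bar R} :=
  product_power (@lebesgue_measure R) n.

Section orlicz.
Context {R : realType}.
Implicit Type psi : R -> R.

(* Only the values of [psi] on [0, +oo[ matter. *)
Definition young_function psi :=
  [/\ forall x, 0 <= x -> 0 <= psi x,
      convex_function (E := R^o) `[0, +oo[ psi &
      forall x, 0 <= x -> (psi x = 0 <-> x = 0)].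

Definition exp_young_function (alpha : R) psi :=
  young_function psi /\ \forall x \near +oo, psi x = expR (x `^ alpha) - 1.

(* The infimum is taken in [\bar R], hence is +oo on the empty set. *)
Definition orlicz_norm psi d (T : measurableType d)
    (mu : {measure set T -> \bar R}) (D : set T) (f : T -> R) : \bar R :=
  ereal_inf [set K%:E | K in [set K : R |
    0 < K /\ (\int[mu]_(x in D) (psi (`|f x| / K))%:E <= 1)%E]].

End orlicz.

Section discrepancy.
Context {R : realType} (d : nat).
Implicit Type x : d.-tuple R.

Definition unit_cube : set (d.-tuple R) :=
  [set x | forall i, `[0, 1[%classic (tnth x i)].

Definition anchored_box x : set (d.-tuple R) :=
  [set z | forall i, `[0, tnth x i[%classic (tnth z i)].

Definition discrepancy (P : {fset d.-tuple R}) x : R :=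
  \sum_(z <- P) \1_(anchored_box x) z
  - #|` P|%fset%:R * \prod_(i < d) tnth x i.

End discrepancy.
Arguments unit_cube {R} d.

Lemma lebesgue_tuple_unit_cube (R : realType) d :
  lebesgue_tuple d (@unit_cube R d) = 1%E.
Proof.
rewrite [LHS](@product_power_box _ _ _ (@lebesgue_measure R) d
  (fun=> `[0%R, 1%R[%classic)) => [|i]; last exact: measurable_itv.
by rewrite big1 // => i _; rewrite [LHS]lebesgue_measure_itv /= lte01 oppr0 adde0.
Qed.

(* Main.v *)
Require Import Defs.
From mathcomp Require Import all_boot all_order all_algebra finmap.
From mathcomp Require Import all_classical all_reals all_analysis.
From mathcomp Require Import measurable_realfun.
From mathcomp Require Import ring lra zify.

Set Implicit Arguments.
Unset Strict Implicit.
Unset Printing Implicit Defensive.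

Import Order.TTheory GRing.Theory Num.Theory.
Import numFieldNormedType.Exports.

Local Open Scope classical_set_scope.
Local Open Scope ring_scope.

(** Put s = d - 1.  At the endpoint beta = 2 / s the claim says that the L^p
    norms of the discrepancy are O((p log N)^(s/2)), and for beta = +oo it is
    the star discrepancy bound O((log N)^s).  One family of point sets
    satisfies both, and the values of beta in between follow by interpolation:
    if v <= 1 is the discrepancy divided by a bound for its supremum, then
    v^beta <= v^(2/s) ([exp_chaos_bound]).

    The point sets are shifted Halton sets: the points (k / N, y_(t+k)) for
    k < N, where the i-th coordinate of y_u is the n-digit radical inverse of
    u in the base b_i, the bases are pairwise coprime, N <= 2^n with n of
    order log N, and the shift t ranges over the residues modulo
    P = prod_i b_i^n.  The Orlicz norm only involves one integral over x, so
    it suffices to bound, for each fixed x, the average over t of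
    exp((|D_t(x)| / K)^beta); exchanging the average with the integral then
    produces a good shift.

    Fix x.  The indicator of [0, x_i) at a radical inverse is the end of a
    martingale: after j digits of u are known, the expected value of the
    indicator is the fraction of the current b_i-adic interval that lies below
    x_i.  Writing it as the sum of the martingale increments and expanding the
    product over i turns D_t(x), up to an error s + 1, into a sum of (n + 1)^s
    terms T_l(t), one for each vector l of levels.  By the Chinese remainder
    theorem the product of increments behind T_l has period prod_i b_i^(l_i)
    and mean zero, and it vanishes outside one residue class modulo
    prod_i b_i^(l_i - 1); hence |T_l| <= prod_i b_i
    ([increment_product_window]).  Summing over l gives the star discrepancy
    bound.

    For the moments, T_l is, separately in each coordinate i, a martingale
    difference in l_i for the filtration of t modulo b_i^j.  The pointwise
    inequality [exprDn_smooth] expresses that L^(2q) is 2-smooth with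
    constant of order q, so a martingale with r differences bounded by B in
    L^(2q) has 2q-th moment at most (4 q r)^q B^(2q) ([martingale_moment]).
    Applying this once in each coordinate yields (4 q (n + 1))^(q s)
    ([level_sum_moment]), which is the growth in q that the exponential
    series needs ([exp_moment]). *)

(** * Moments of martingales *)

Lemma exprn_tangent (R : realFieldType) (n : nat) (a b : R) :
  0 <= a -> 0 <= b -> a ^+ n.+1 + n.+1%:R * a ^+ n * (b - a) <= b ^+ n.+1.
Proof.
move=> a0 b0; elim: n => [|n IH]; first by rewrite expr0 !expr1 mulr1; lra.
have /(ler_wpM2l b0) := IH; rewrite -exprS; apply: le_trans.
have h : 0 <= n.+1%:R * a ^+ n * (b - a) ^+ 2.
  by rewrite mulr_ge0 ?sqr_ge0// mulr_ge0 ?exprn_ge0// ler0n.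
rewrite -subr_ge0; apply: le_trans h _; rewrite le_eqVlt; apply/orP; left; apply/eqP.
rewrite -[n.+2%:R]natr1 !exprS; ring.
Qed.

(** Convexity of an even power, on the whole line: replacing x and y by their
    absolute values only increases the mixed term. *)
Lemma exprn_even_tangent (R : realFieldType) (q : nat) (x y : R) :
  (0 < q)%N -> x ^+ (2 * q) + (2 * q)%:R * x ^+ (2 * q).-1 * (y - x) <= y ^+ (2 * q).
Proof.
move=> q0.
have [n qE] : exists n, (2 * q)%N = n.+1 by exists (2 * q).-1; lia.
have nodd : odd n by have := congr1 odd qE; rewrite /= oddM /=; case: odd.
have ev (z : R) : z ^+ n.+1 = `|z| ^+ n.+1.
  by rewrite -normrX ger0_norm// exprn_even_ge0//= nodd.
rewrite qE /= (ev y); apply: le_trans (exprn_tangent n (normr_ge0 x) (normr_ge0 y)).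
have -> : n.+1%:R * x ^+ n * (y - x) = n.+1%:R * (x ^+ n * y - x ^+ n.+1).
  by rewrite exprSr -mulrA mulrBr.
have -> : n.+1%:R * `|x| ^+ n * (`|y| - `|x|) = n.+1%:R * (`|x| ^+ n * `|y| - x ^+ n.+1).
  by rewrite (ev x) exprSr -mulrA mulrBr.
rewrite -(ev x) lerD2l ler_wpM2l ?ler0n// lerB//.
by rewrite -normrX -normrM ler_norm.
Qed.

Lemma sum_even_odd (R : nmodType) (q : nat) (F : nat -> R) :
  \sum_(i < (2 * q).+1) F i =
  \sum_(k < q.+1) F (2 * k)%N + \sum_(k < q) F (2 * k).+1.
Proof.
elim: q => [|q IH]; first by rewrite muln0 !big_ord_recr !big_ord0 /= addr0.
have -> : (2 * q.+1)%N = (2 * q).+2 by lia.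
rewrite 2!big_ord_recr /= IH.
rewrite [in RHS]big_ord_recr /= [\sum_(k < q.+1) F (2 * k).+1]big_ord_recr /=.
have -> : (2 * q.+1)%N = (2 * q).+2 by lia.
by rewrite -!addrA; congr (_ + _); rewrite addrA addrC.
Qed.

(** The ratio of the two binomials is the product over j < k of
    (2q - 2j - 1) / (2j + 1), each factor being at most 2q. *)
Lemma bin_double_le (q k : nat) : ('C(2 * q, 2 * k) <= 'C(q, k) * (2 * q) ^ k)%N.
Proof.
elim: k => [|k IH]; first by rewrite !bin0.
have -> : (2 * k.+1)%N = (2 * k).+2 by lia.
have h1 := mul_bin_left (2 * q) (2 * k).+1.
have h2 := mul_bin_left (2 * q) (2 * k).
have h3 := mul_bin_left q k.
rewrite -(leq_pmul2l (_ : 0 < (2 * k).+2 * (2 * k).+1)%N) //.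
have -> : ((2 * k).+2 * (2 * k).+1 * 'C(2 * q, (2 * k).+2) =
  (2 * q - (2 * k).+1) * ((2 * q - 2 * k) * 'C(2 * q, 2 * k)))%N.
  rewrite -h2; nia.
have -> : ((2 * k).+2 * (2 * k).+1 * ('C(q, k.+1) * (2 * q) ^ k.+1) =
   2 * (2 * k).+1 * (2 * q) * (2 * q) ^ k * ((q - k) * 'C(q, k)))%N.
  rewrite -h3 expnS; nia.
have -> : (2 * q - 2 * k = 2 * (q - k))%N by lia.
move: ('C(2 * q, 2 * k)) ('C(q, k)) ((2 * q) ^ k)%N IH => u v w IH.
have -> : (2 * (2 * k).+1 * (2 * q) * w * ((q - k) * v) =
  (2 * k).+1 * (2 * q) * (2 * (q - k) * (v * w)))%N by nia.
apply: leq_mul; first by nia.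
by rewrite leq_mul2l IH orbT.
Qed.

(** This is 2-smoothness of L^(2q) in pointwise form: the term linear in g has
    mean zero when g is a martingale difference over f.  The odd powers of g
    are removed by adding (f - g)^(2q), which is at least
    f^(2q) - 2 q f^(2q-1) g by convexity; what is left has only even powers
    and is compared coefficient by coefficient. *)
Lemma exprDn_smooth (R : realFieldType) (q : nat) (f g : R) : (0 < q)%N ->
  (f + g) ^+ (2 * q) <=
  (f ^+ 2 + (4 * q)%:R * g ^+ 2) ^+ q + (2 * q)%:R * f ^+ (2 * q).-1 * g.
Proof.
move=> q0.
have := exprn_even_tangent f (f - g) q0.
have -> : f - g - f = - g by ring.
rewrite mulrN => tang.
suff : (f + g) ^+ (2 * q) + (f - g) ^+ (2 * q) <=
   (f ^+ 2 + (4 * q)%:R * g ^+ 2) ^+ q + f ^+ (2 * q) by lra.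
have -> : (f + g) ^+ (2 * q) + (f - g) ^+ (2 * q) =
    \sum_(k < q.+1) (2 * 'C(2 * q, 2 * k))%:R * (f ^+ (2 * (q - k)) * g ^+ (2 * k)).
  pose F i := f ^+ (2 * q - i) * (g ^+ i + (- g) ^+ i) *+ 'C(2 * q, i).
  rewrite !exprDn -big_split /= (eq_bigr (fun i : 'I_(2 * q).+1 => F i)); last first.
    by move=> i _; rewrite /F mulrDr mulrnDl.
  rewrite sum_even_odd [X in _ + X = _]big1 ?addr0; last first.
    move=> i _; rewrite /F [(- g) ^+ _]exprNn -signr_odd /= oddM /= expr1 mulN1r.
    by rewrite subrr mulr0 mul0rn.
  apply: eq_bigr => k _; rewrite /F [(- g) ^+ _]exprNn -signr_odd oddM /= expr0 mul1r.
  by rewrite -mulnBr -mulr2n mulrnAr -mulrnA mulr_natl.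
rewrite exprDn !big_ord_recl /= muln0 !bin0 !subn0 !expr0 !mulr1 -exprM mulr1n.
rewrite muln1 mulr_natl mulr2n [leRHS]addrAC -[leRHS]addrA -[leLHS]addrA !lerD2l.
apply: ler_sum => k _; rewrite -exprM [(_ * g ^+ 2) ^+ _]exprMn -exprM.
rewrite -[leRHS]mulr_natl; set u := bump 0 k.
have -> : 'C(q, u)%:R * (f ^+ (2 * (q - u)) * ((4 * q)%:R ^+ u * g ^+ (2 * u))) =
    ('C(q, u) * (4 * q) ^ u)%:R * (f ^+ (2 * (q - u)) * g ^+ (2 * u)) :> R.
  by rewrite (natrM _ 'C(q, u)) natrX; ring.
apply: ler_wpM2r; first by rewrite mulr_ge0// exprn_even_ge0// oddM.
rewrite ler_nat (_ : 4 * q = 2 * (2 * q))%N; last by lia.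
rewrite expnMn mulnCA; apply: leq_mul; last exact: bin_double_le.
by rewrite -[leqLHS]expn1 leq_exp2l.
Qed.

(** Jensen for the (q+1)-st power with weights K / (K + 1) and 1 / (K + 1),
    applied to u / K and v and cleared of denominators; proved by adding the two
    tangent inequalities at the mean m. *)
Lemma exprDn_convex (R : realFieldType) (q : nat) (K u v : R) :
  0 < K -> 0 <= u -> 0 <= v ->
  K ^+ q * (u + v) ^+ q.+1 <= (K + 1) ^+ q * (u ^+ q.+1 + K ^+ q * v ^+ q.+1).
Proof.
move=> K0 u0 v0.
pose m := (u + v) / (K + 1).
have K10 : 0 < K + 1 by rewrite addr_gt0.
have m0 : 0 <= m by apply: divr_ge0; [exact: addr_ge0|exact: ltW].
have uv : u + v = m * (K + 1) by rewrite divfK// gt_eqF.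
have uK0 : 0 <= u / K by rewrite divr_ge0// ltW.
have h1 := exprn_tangent q m0 uK0.
have h2 := exprn_tangent q m0 v0.
have h : (K + 1) * m ^+ q.+1 <= K * (u / K) ^+ q.+1 + v ^+ q.+1.
  have /(ler_wpM2l (ltW K0)) := h1.
  rewrite -(lerD2r (v ^+ q.+1)); apply: le_trans.
  rewrite -(lerD2l (K * (m ^+ q.+1 + q.+1%:R * m ^+ q * (u / K - m)))) in h2.
  apply: le_trans h2; rewrite le_eqVlt; apply/orP; left; apply/eqP.
  have -> : v = m * (K + 1) - u by rewrite -uv; ring.
  by field; rewrite gt_eqF.
have KK0 : 0 <= K ^+ q * (K + 1) ^+ q by rewrite mulr_ge0// exprn_ge0// ltW.
have hh := ler_wpM2l KK0 h.
have -> : K ^+ q * (u + v) ^+ q.+1 =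
    K ^+ q * (K + 1) ^+ q * ((K + 1) * m ^+ q.+1).
  by rewrite uv exprMn [(K + 1) ^+ q.+1]exprS; ring.
apply: le_trans hh _; rewrite le_eqVlt; apply/orP; left; apply/eqP.
rewrite exprMn exprVn (exprS K); field.
by rewrite ?expf_neq0// gt_eqF.
Qed.

Lemma exprD_moment (R : realFieldType) (q : nat) (u v : R) :
  (u + v) ^+ (2 * q.+1) <= 2^-1 * 4 ^+ q.+1 * (u ^+ (2 * q.+1) + v ^+ (2 * q.+1)).
Proof.
have h : (u + v) ^+ 2 <= 2 * u ^+ 2 + 2 * v ^+ 2.
  have -> : 2 * u ^+ 2 + 2 * v ^+ 2 = (u + v) ^+ 2 + (u - v) ^+ 2 by ring.
  by rewrite lerDl sqr_ge0.
rewrite !exprM.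
apply: (@le_trans _ _ ((2 * u ^+ 2 + 2 * v ^+ 2) ^+ q.+1)).
  by rewrite lerXn2r ?nnegrE ?sqr_ge0// (le_trans _ h)// sqr_ge0.
have u2 : 0 <= 2 * u ^+ 2 by rewrite mulr_ge0// sqr_ge0.
have v2 : 0 <= 2 * v ^+ 2 by rewrite mulr_ge0// sqr_ge0.
have := exprDn_convex q ltr01 u2 v2.
rewrite !expr1n !mul1r; move/le_trans; apply.
have -> : 1 + 1 = 2 :> R by ring.
have -> : 4 = 2 * 2 :> R by ring.
move: (u ^+ 2) (v ^+ 2) => U V; rewrite !exprMn (exprS 2 q).
by rewrite le_eqVlt; apply/orP; left; apply/eqP; field.
Qed.

Definition periodic (T : Type) (P : nat) (f : nat -> T) := forall k, f (k + P)%N = f k.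

Lemma periodic_sum_shift (V : zmodType) (P : nat) (f : nat -> V) (c : nat) :
  periodic P f -> \sum_(k < P) f (k + c)%N = \sum_(k < P) f k.
Proof.
move=> fP; elim: c => [|c IH]; first by under eq_bigr do rewrite addn0.
rewrite -{}IH; case: P fP => [|P] fP; first by rewrite !big_ord0.
rewrite big_ord_recr [RHS]big_ord_recl /= addrC; congr (_ + _).
  by rewrite add0n -[RHS]fP; congr f; lia.
by apply: eq_bigr => i _; rewrite /bump/= ; congr f; lia.
Qed.

(** The induction splits X + d with [exprDn_smooth], then uses
    [exprDn_convex] with K the number of differences summed so far, which is
    the choice that makes the bound grow exactly linearly in that number.
    The term d 0 is the starting value of the martingale, so orthogonality is
    only asked of the later ones.  Expectations are unnormalised sums over
    t < P. *)
Lemma martingale_moment (R : realFieldType) (P q : nat) (n : nat)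
    (d : nat -> nat -> R) (B : R) :
  (forall a, (a <= n)%N -> \sum_(t < P) d a t ^+ (2 * q.+1) <= B) ->
  (forall a, (a < n)%N ->
    \sum_(t < P) (\sum_(i < a.+1) d i t) ^+ (2 * q.+1).-1 * d a.+1 t = 0) ->
  \sum_(t < P) (\sum_(i < n.+1) d i t) ^+ (2 * q.+1) <= (4 * q.+1 * n.+1)%:R ^+ q.+1 * B.
Proof.
elim: n => [|n IH] dB dM.
  under eq_bigr do rewrite big_ord_recl big_ord0 addr0.
  rewrite muln1 natrM; have dB0 := dB 0%N isT; apply: le_trans (dB0) _.
  have B0 : 0 <= B.
    by apply: le_trans dB0; apply: sumr_ge0 => i _; rewrite exprn_even_ge0// oddM.
  rewrite ler_peMl// -natrM exprn_ege1// ler1n; lia.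
have {}IH := IH (fun a an => dB a (leqW an)) (fun a an => dM a (leqW an)).
have {dM} dMn := dM n (ltnSn _).
pose X t := \sum_(i < n.+1) d i t.
have XS t : \sum_(i < n.+2) d i t = X t + d n.+1 t by rewrite big_ord_recr.
under eq_bigr do rewrite XS.
apply: (@le_trans _ _ (\sum_(t < P) (X t ^+ 2 + (4 * q.+1)%:R * d n.+1 t ^+ 2) ^+ q.+1)).
  have addM (Y : R) :
      Y = Y + (2 * q.+1)%:R * \sum_(t < P) X t ^+ (2 * q.+1).-1 * d n.+1 t.
    by rewrite dMn mulr0 addr0.
  rewrite [leRHS]addM mulr_sumr -big_split.
  by apply: ler_sum => t _ /=; rewrite mulrA; exact: exprDn_smooth.
rewrite -(ler_pM2l (_ : 0 < n.+1%:R ^+ q)); last by rewrite exprn_gt0// ltr0n.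
apply: (@le_trans _ _ (\sum_(t < P) n.+2%:R ^+ q * (X t ^+ (2 * q.+1) +
    n.+1%:R ^+ q * ((4 * q.+1)%:R ^+ q.+1 * d n.+1 t ^+ (2 * q.+1))))).
  rewrite mulr_sumr; apply: ler_sum => t _.
  rewrite (exprM (X t)) (exprM (d n.+1 t)) -exprMn.
  rewrite -[n.+2%:R]natr1; apply: exprDn_convex; rewrite ?ltr0n ?sqr_ge0//.
  by rewrite mulr_ge0 ?ler0n ?sqr_ge0.
rewrite -mulr_sumr big_split /= -!mulr_sumr.
have h2 : (4 * q.+1)%:R ^+ q.+1 * (\sum_(t < P) d n.+1 t ^+ (2 * q.+1))
   <= (4 * q.+1)%:R ^+ q.+1 * B.
  by apply: ler_wpM2l; rewrite ?exprn_ge0 ?ler0n// dB.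
have h3 : n.+1%:R ^+ q * ((4 * q.+1)%:R ^+ q.+1 * (\sum_(t < P) d n.+1 t ^+ (2 * q.+1)))
   <= n.+1%:R ^+ q * ((4 * q.+1)%:R ^+ q.+1 * B).
  by apply: ler_wpM2l; rewrite ?exprn_ge0 ?ler0n.
apply: le_trans (ler_wpM2l _ (lerD IH h3)) _; first by rewrite exprn_ge0 ?ler0n.
rewrite le_eqVlt; apply/orP; left; apply/eqP.
rewrite !natrM !exprMn !(exprS _ q) -[n.+2%:R]natr1; ring.
Qed.

(** * Multi-parameter martingales *)

(** Sum over all vectors of s levels in {0..n}, the vectors being represented
    as lists; peeling off one coordinate at a time is what the induction over
    the parameters of a martingale uses. *)
Fixpoint level_sum (R : nmodType) (n s : nat) (T : seq 'I_n.+1 -> R) : R :=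
  if s is s'.+1 then \sum_(a < n.+1) level_sum s' (fun l => T (a :: l)) else T [::].

Lemma eq_level_sum (R : nmodType) (n s : nat) (T T' : seq 'I_n.+1 -> R) :
  (forall l, size l = s -> T l = T' l) -> level_sum s T = level_sum s T'.
Proof.
elim: s T T' => [|s IH] T T' TT' /=; first exact: TT'.
by apply: eq_bigr => a _; apply: IH => l ls; apply: TT'; rewrite /= ls.
Qed.

Lemma exchange_level_sum (R : nmodType) (n s : nat) (I : Type) (r : seq I)
    (T : seq 'I_n.+1 -> I -> R) :
  \sum_(t <- r) level_sum s (T^~ t) = level_sum s (fun l => \sum_(t <- r) T l t).
Proof.
elim: s T => [|s IH] T //=; rewrite exchange_big /=.
by apply: eq_bigr => a _; rewrite (IH (fun l => T (a :: l))).
Qed.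

Lemma level_sum0 (R : nmodType) (n s : nat) (T : seq 'I_n.+1 -> R) :
  (forall l, size l = s -> T l = 0) -> level_sum s T = 0.
Proof.
elim: s T => [|s IH] T T0 /=; first exact: T0.
by apply: big1 => a _; apply: IH => l ls; apply: T0; rewrite /= ls.
Qed.

Lemma level_sum_delta (R : nmodType) (n s : nat) (v : R) :
  level_sum s (fun l : seq 'I_n.+1 => if all (pred1 ord0) l then v else 0) = v.
Proof.
elim: s => [|s IH] //=; rewrite big_ord_recl /= IH big1 ?addr0// => a _.
exact: level_sum0.
Qed.

Lemma level_sumD (R : nmodType) (n s : nat) (T T' : seq 'I_n.+1 -> R) :
  level_sum s (fun l => T l + T' l) = level_sum s T + level_sum s T'.
Proof.
elim: s T T' => [|s IH] T T' //=; rewrite -big_split; apply: eq_bigr => a _.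
by rewrite (IH (fun l => T (a :: l))).
Qed.

Lemma level_sumZ (R : pzSemiRingType) (n s : nat) (c : R) (T : seq 'I_n.+1 -> R) :
  level_sum s (fun l => c * T l) = c * level_sum s T.
Proof.
elim: s T => [|s IH] T //=; rewrite mulr_sumr.
by apply: eq_bigr => a _; rewrite (IH (fun l => T (a :: l))).
Qed.

Lemma level_sum_prod (R : pzSemiRingType) (n s : nat) (F : nat -> 'I_n.+1 -> R) :
  level_sum s (fun l => \prod_(i < s) F i (nth ord0 l i)) =
  \prod_(i < s) \sum_(a < n.+1) F i a.
Proof.
elim: s F => [|s IH] F /=; first by rewrite !big_ord0.
rewrite [RHS]big_ord_recl mulr_suml; apply: eq_bigr => a _.
rewrite -(IH (fun i => F i.+1)) -level_sumZ; apply: eq_level_sum => l _.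
by rewrite big_ord_recl.
Qed.

Lemma level_sum_norm (R : realFieldType) (n s : nat) (B : R) (T : seq 'I_n.+1 -> R) :
  (forall l, size l = s -> `|T l| <= B) -> `|level_sum s T| <= n.+1%:R ^+ s * B.
Proof.
elim: s T => [|s IH] T TB /=; first by rewrite mul1r TB.
apply: le_trans (ler_norm_sum _ _ _) _.
apply: (@le_trans _ _ (\sum_(a < n.+1) n.+1%:R ^+ s * B)).
  by apply: ler_sum => a _; apply: IH => l ls; apply: TB; rewrite /= ls.
by rewrite sumr_const card_ord -[leLHS]mulr_natl exprS mulrA.
Qed.

Lemma periodic_mul (T : Type) (P : nat) (f : nat -> T) (m k : nat) :
  periodic P f -> f (k + m * P)%N = f k.
Proof. by move=> fP; elim: m => [|m IH]; rewrite ?addn0// mulSnr addnA fP. Qed.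

(** An s-parameter version of [martingale_moment], applied to one coordinate
    after the other.  Conditional expectations are expressed by translations:
    translating by c i a fixes the terms whose i-th level is below a, and
    averages the terms of i-th level a to zero over b i steps.  Since the sums
    over t < P of periodic functions are translation invariant, this gives
    the orthogonality that [martingale_moment] asks for. *)
Lemma level_sum_moment (R : realFieldType) (P q n s : nat) (b : nat -> nat)
    (c : nat -> nat -> nat) (B : R) (T : seq 'I_n.+1 -> nat -> R) :
  (forall i, 0 < b i)%N ->
  (forall l, size l = s -> periodic P (T l)) ->
  (forall l i a, size l = s -> (i < s)%N -> (nth ord0 l i < a <= n)%N ->
    periodic (c i a) (T l)) ->
  (forall l i t, size l = s -> (i < s)%N -> (0 < nth ord0 l i)%N ->
    \sum_(e < b i) T l (t + e * c i (nth ord0 l i))%N = 0) ->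
  (forall l t, size l = s -> `|T l t| <= B) ->
  \sum_(t < P) level_sum s (T^~ t) ^+ (2 * q.+1) <=
    ((4 * q.+1 * n.+1)%:R ^+ q.+1) ^+ s * (P%:R * B ^+ (2 * q.+1)).
Proof.
move=> b0; elim: s T b c b0 => [|s IH] T b c b0 TP Tc T0 TB /=.
  rewrite expr0 mul1r; apply: (@le_trans _ _ (\sum_(t < P) B ^+ (2 * q.+1))).
    apply: ler_sum => t _; rewrite -[leLHS]ger0_norm; last first.
      by rewrite exprn_even_ge0// oddM.
    by rewrite normrX lerXn2r ?nnegrE ?TB// (le_trans _ (TB [::] t _)).
  by rewrite sumr_const card_ord mulr_natl.
rewrite exprS -mulrA.
pose X a t := level_sum s (fun l => T (inord a :: l) t).
have XE t : \sum_(a < n.+1) level_sum s (fun l => T (a :: l) t) = \sum_(a < n.+1) X a t.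
  by apply: eq_bigr => a _; rewrite /X inord_val.
under eq_bigr do rewrite XE.
apply: martingale_moment => a an.
  apply: (IH (fun l => T (inord a :: l)) (fun i => b i.+1) (fun i => c i.+1)) => //.
  - by move=> l ls; apply: TP; rewrite /= ls.
  - by move=> l i a' ls si; apply: (Tc (inord a :: l) i.+1); rewrite //= ls.
  - by move=> l i t ls si; apply: (T0 (inord a :: l) i.+1); rewrite //= ls.
  - by move=> l t ls; apply: TB; rewrite /= ls.
set f := fun t => \sum_(i < a.+1) X i t.
have fc : periodic (c 0%N a.+1) f.
  move=> t; apply: eq_bigr => i _; apply: eq_level_sum => l ls.
  apply: (Tc (inord i :: l) 0%N) => //=; first by rewrite ls.
  by have ia := ltn_ord i; rewrite inordK ?ia ?an ?(leq_trans ia (leqW an)).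
have X0 t : \sum_(e < b 0%N) X a.+1 (t + e * c 0%N a.+1)%N = 0.
  rewrite /X (exchange_level_sum _ _ (fun l (e : 'I_(b 0%N)) =>
    T (inord a.+1 :: l) (t + e * c 0%N a.+1)%N)).
  apply: level_sum0 => l ls.
  have := T0 (inord a.+1 :: l) 0%N t; rewrite /= inordK// => -> //.
  by rewrite ls.
have XP i : periodic P (X i).
  by move=> t; apply: eq_level_sum => l ls; apply: TP; rewrite /= ls.
have fP : periodic P f by move=> t; apply: eq_bigr => i _; exact: XP.
pose g t := f t ^+ (2 * q.+1).-1 * X a.+1 t.
have gP : periodic P g by move=> t; rewrite /g fP XP.
(* Along the orbit of the translation by c 0 a.+1 the factor f is constant,
   and the values of X a.+1 add up to zero. *)
have : \sum_(e < b 0%N) \sum_(t < P) g (t + e * c 0%N a.+1)%N = 0.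
  rewrite exchange_big /= big1// => t _.
  rewrite /g (eq_bigr (fun e : 'I_(b 0%N) =>
    f t ^+ (2 * q.+1).-1 * X a.+1 (t + e * c 0%N a.+1)%N)).
    by rewrite -mulr_sumr X0 mulr0.
  by move=> e _; rewrite periodic_mul.
under eq_bigr do rewrite periodic_sum_shift//.
rewrite sumr_const card_ord => /eqP; rewrite mulrn_eq0 => /orP[/eqP b00|/eqP //].
by have := b0 0%N; rewrite b00.
Qed.

(** * Radical inverses and interval martingales *)

(** The reversal of the j lowest base-b digits of u, as an integer; the usual
    radical inverse is its quotient by b^j.  Digits are appended on the right as
    j grows, so that reversal modulo b^j is refined by reversal modulo
    b^(j+1). *)
Fixpoint radical_inverse (b j u : nat) : nat :=
  if j is j'.+1 then (b * radical_inverse b j' u + (u %/ b ^ j') %% b)%N else 0%N.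

Lemma radical_inverse_lt (b j u : nat) : (0 < b)%N -> (radical_inverse b j u < b ^ j)%N.
Proof.
move=> b0; elim: j => [|j IH] //=.
by have := ltn_pmod (u %/ b ^ j) b0; rewrite expnS; nia.
Qed.

Lemma digit_mod (b j u : nat) : (0 < b)%N ->
  ((u %/ b ^ j) %% b = (u %% b ^ j.+1) %/ b ^ j)%N.
Proof. by move=> b0; rewrite expnS -modn_divl// expn_gt0 b0. Qed.

Lemma radical_inverse_mod (b j u v : nat) : (0 < b)%N ->
  (radical_inverse b j u == radical_inverse b j v) = (u == v %[mod b ^ j]).
Proof.
move=> b0; elim: j => [|j IH]; first by rewrite expn0 !modn1.
have modS w : (w %% b ^ j.+1 = (w %/ b ^ j) %% b * b ^ j + w %% b ^ j)%N.
  by rewrite digit_mod// {1}(divn_eq (w %% b ^ j.+1) (b ^ j)) modn_dvdm// dvdn_exp2l.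
rewrite /= !modS; have bj : (0 < b ^ j)%N by rewrite expn_gt0 b0.
have u1 := ltn_pmod (u %/ b ^ j) b0; have v1 := ltn_pmod (v %/ b ^ j) b0.
have u2 := ltn_pmod u bj; have v2 := ltn_pmod v bj.
move: IH u1 v1 u2 v2; move: (radical_inverse b j u) (radical_inverse b j v).
move: (u %/ b ^ j %% b)%N (v %/ b ^ j %% b)%N (u %% b ^ j)%N (v %% b ^ j)%N.
move: (b ^ j)%N bj => c c0 u1 v1 u2 v2 ru rv IH lu1 lv1 lu2 lv2.
apply/eqP/eqP => h.
  have /eqP := congr1 (divn^~ b) h.
  rewrite !(mulnC b) !divnMDl// !divn_small// !addn0 IH => /eqP e2.
  have /eqP := congr1 (modn^~ b) h.
  by rewrite !(mulnC b) !modnMDl !modn_small// => /eqP ->; rewrite e2.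
have /eqP := congr1 (divn^~ c) h.
rewrite !divnMDl// !divn_small// !addn0 => /eqP ->.
have /eqP := congr1 (modn^~ c) h.
by rewrite !modnMDl !modn_small// -IH => /eqP ->.
Qed.

Section interval_martingale.
Variable R : realFieldType.
Implicit Types t x : R.

Definition clamp t : R := Num.max 0 (Num.min t 1).

Lemma clampP t : [/\ 0 <= clamp t, clamp t <= 1, t <= 0 -> clamp t = 0,
  1 <= t -> clamp t = 1 & 0 <= t <= 1 -> clamp t = t].
Proof.
rewrite /clamp; case: (leP t 1) => h1; last first.
  by rewrite (max_r ler01) andbF; split => // *; lra.
by case: (leP 0 t) => h2; split => // *; lra.
Qed.

(** An interval of length b cut at t b is cut into b unit intervals, whose parts
    below the cut add up; this is the martingale property of
    [interval_density]. *)
Lemma sum_clamp (b : nat) t : (0 < b)%N ->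
  \sum_(e < b) clamp (b%:R * t - e%:R) = b%:R * clamp t.
Proof.
move=> b0.
have h y : \sum_(e < b) clamp (y - e%:R) = Num.max 0 (Num.min y b%:R).
  elim: b {b0} => [|b IH]; first by rewrite big_ord0 max_l// ge_min lexx orbT.
  rewrite big_ord_recr /= IH -natr1.
  have : 0 <= b%:R :> R by rewrite ler0n.
  move: (b%:R : R) => c c0; have [_ _ cl0 cl1 clid] := clampP (y - c).
  case: (leP y c) => yc.
    by rewrite cl0 ?subr_le0// addr0 min_l// (le_trans yc)// lerDl.
  rewrite max_r//; case: (leP y (c + 1)) => yc1.
    rewrite clid; last by rewrite subr_ge0 ltW//= lerBlDl.
    by rewrite max_r ?(le_trans c0 (ltW yc))// addrC subrK.
  by rewrite cl1 ?lerBrDl ?(ltW yc1)// max_r// addr_ge0.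
rewrite h /clamp; have : 0 < b%:R :> R by rewrite ltr0n.
move: (b%:R : R) => c c0.
by rewrite maxr_pMr ?minr_pMr ?mulr0 ?mulr1// ltW.
Qed.

(** The conditional expectation of the indicator of [0, x) given the first j
    digits: the fraction of the b-adic interval of length b^-j containing the
    radical inverse of u that lies below x. *)
Definition interval_density (b : nat) x (j u : nat) : R :=
  clamp (x * b%:R ^+ j - (radical_inverse b j u)%:R).

Definition interval_increment (b : nat) x (j u : nat) : R :=
  if j is j'.+1 then interval_density b x j u - interval_density b x j' u else x.

Lemma sum_interval_increment (b n : nat) x u : 0 <= x <= 1 ->
  \sum_(a < n.+1) interval_increment b x a u = interval_density b x n u.
Proof.
move=> x01; elim: n => [|n IH].
  rewrite big_ord_recl big_ord0 /= addr0 /interval_density expr0 mulr1 subr0.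
  by have [_ _ _ _ ->] := clampP x.
by rewrite big_ord_recr IH /= addrC subrK.
Qed.

Lemma interval_density_mod (b j u v : nat) x : (0 < b)%N -> u = v %[mod b ^ j] ->
  interval_density b x j u = interval_density b x j v.
Proof.
move=> b0 /eqP; rewrite -radical_inverse_mod// => /eqP uv.
by rewrite /interval_density uv.
Qed.

Lemma interval_increment_mod (b j u v : nat) x : (0 < b)%N -> u = v %[mod b ^ j] ->
  interval_increment b x j u = interval_increment b x j v.
Proof.
move=> b0; case: j => // j uv /=; congr (_ - _); apply: interval_density_mod => //.
by rewrite -(modn_dvdm u (dvdn_exp2l b (leqnSn j))) uv modn_dvdm// dvdn_exp2l.
Qed.

Lemma interval_increment_norm (b j u : nat) x : 0 <= x <= 1 ->
  `|interval_increment b x j u| <= 1.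
Proof.
case: j => [|j] /= x01; first by rewrite ger0_norm; lra.
rewrite /interval_density.
have [? ? _ _ _] := clampP (x * b%:R ^+ j.+1 - (radical_inverse b j.+1 u)%:R).
have [? ? _ _ _] := clampP (x * b%:R ^+ j - (radical_inverse b j u)%:R).
by rewrite ler_norml; lra.
Qed.

Lemma interval_densityS (b j u : nat) x :
  interval_density b x j.+1 u =
  clamp (b%:R * (x * b%:R ^+ j - (radical_inverse b j u)%:R) - (u %/ b ^ j %% b)%:R).
Proof. by rewrite /interval_density /= natrD natrM exprS; congr clamp; ring. Qed.

(** Adding multiples of b^j to u cycles through the j-th digit and keeps the
    lower ones, so this is the martingale difference property. *)
Lemma interval_increment_sum0 (b j u : nat) x : (0 < b)%N ->
  \sum_(e < b) interval_increment b x j.+1 (u + e * b ^ j)%N = 0.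
Proof.
move=> b0 /=; have bj : (0 < b ^ j)%N by rewrite expn_gt0 b0.
have densE e : interval_density b x j (u + e * b ^ j)%N = interval_density b x j u.
  by apply: interval_density_mod => //; rewrite addnC modnMDl.
rewrite big_split /=; under [X in _ + X]eq_bigr do rewrite densE.
rewrite sumr_const card_ord mulNrn; apply/eqP; rewrite subr_eq0; apply/eqP.
rewrite -[RHS]mulr_natl -sum_clamp//.
set t := x * b%:R ^+ j - _.
pose f e : R := clamp (b%:R * t - (e %% b)%:R).
transitivity (\sum_(e < b) f (e + u %/ b ^ j)%N).
  apply: eq_bigr => e _; rewrite interval_densityS /f.
  have -> : radical_inverse b j (u + e * b ^ j) = radical_inverse b j u.
    by apply/eqP; rewrite radical_inverse_mod// addnC modnMDl.
  by rewrite addnC divnMDl.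
rewrite periodic_sum_shift => [|k]; last by rewrite /f modnDr.
by apply: eq_bigr => e _; rewrite /f modn_small.
Qed.

Lemma unit_window_inj (t : R) (m n : nat) :
  0 < t - m%:R < 1 -> 0 < t - n%:R < 1 -> m = n.
Proof.
move=> /andP[m0 m1] /andP[n0 n1]; apply/eqP; rewrite eqn_leq -ltnS -(ltnS n).
by rewrite -!(ltr_nat R) -!natr1; apply/andP; split; lra.
Qed.

(** The increment vanishes unless x lies inside the current b-adic interval,
    that is unless the reversal of u is the integer part of x b^j. *)
Lemma interval_increment_support (b j u v : nat) x : (0 < b)%N ->
  interval_increment b x j.+1 u != 0 -> interval_increment b x j.+1 v != 0 ->
  u = v %[mod b ^ j].
Proof.
move=> b0.
have supp w : interval_increment b x j.+1 w != 0 ->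
    0 < x * b%:R ^+ j - (radical_inverse b j w)%:R < 1.
  rewrite /= interval_densityS /interval_density.
  set t := x * _ - _; set e := (w %/ _ %% _)%N.
  have eb : e%:R + 1 <= b%:R :> R by rewrite natr1 ler_nat ltn_pmod.
  have e0 : 0 <= e%:R :> R by rewrite ler0n.
  have [_ _ t0 t1 _] := clampP t; have [_ _ bt0 bt1 _] := clampP (b%:R * t - e%:R).
  case: (leP t 0) => ht0; first by rewrite t0// bt0 ?subrr ?eqxx//; nra.
  by case: (ltP t 1) => ht1 //; rewrite t1// bt1 ?subrr ?eqxx//; nra.
move=> /supp u01 /supp v01; apply/eqP; rewrite -radical_inverse_mod//.
by apply/eqP; exact: unit_window_inj u01 v01.
Qed.

(** After n digits the martingale differs from the indicator only on the one
    interval of length b^-n that contains x. *)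
Definition indicator_error (b : nat) x (n u : nat) : R :=
  ((radical_inverse b n u)%:R / b%:R ^+ n < x)%R%:R - interval_density b x n u.

Lemma indicator_error_support (b n u v : nat) x : (0 < b)%N ->
  indicator_error b x n u != 0 -> indicator_error b x n v != 0 -> u = v %[mod b ^ n].
Proof.
move=> b0.
have bn : 0 < b%:R ^+ n :> R by rewrite exprn_gt0// ltr0n.
have supp w : indicator_error b x n w != 0 ->
    0 < x * b%:R ^+ n - (radical_inverse b n w)%:R < 1.
  rewrite /indicator_error ltr_pdivrMr// /interval_density -subr_gt0.
  set t := x * _ - _.
  have [_ _ t0 t1 _] := clampP t.
  case: (ltP 0 t) => ht0; last by rewrite t0 ?subrr ?eqxx.
  by case: (ltP t 1) => ht1 //; rewrite t1 ?subrr ?eqxx.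
move=> /supp u01 /supp v01; apply/eqP; rewrite -radical_inverse_mod//.
by apply/eqP; exact: unit_window_inj u01 v01.
Qed.

Lemma interval_density01 (b n u : nat) x : 0 <= interval_density b x n u <= 1.
Proof. by rewrite /interval_density; set t := _ - _; have [-> -> _ _ _] := clampP t. Qed.

End interval_martingale.

(** * Sums of products of increments over windows *)

Lemma coprime_prodr (s m : nat) (F : nat -> nat) (Q : pred nat) :
  (forall i, (i < s)%N -> Q i -> coprime m (F i)) ->
  coprime m (\prod_(i < s | Q i) F i).
Proof.
move=> co; elim/big_ind: _ => [|x y mx my|i Qi]; first exact: coprimen1.
  by rewrite coprimeMr mx my.
exact: co.
Qed.

Lemma eqmod_prod (s : nat) (m : nat -> nat) (k k' : nat) :
  (forall i j, i != j -> coprime (m i) (m j)) ->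
  (forall i, (i < s)%N -> k = k' %[mod m i]) -> k = k' %[mod \prod_(i < s) m i].
Proof.
move=> co; elim: s => [|s IH] kk; first by rewrite big_ord0 !modn1.
apply/eqP; rewrite big_ord_recr /= chinese_remainder; last first.
  rewrite coprime_sym; apply: (@coprime_prodr _ _ m xpredT) => i si _.
  by apply: co; rewrite gtn_eqF.
by rewrite kk// eqxx andbT; apply/eqP/IH => i si; apply: kk; exact: ltnW.
Qed.

(** The translations used in [level_sum_moment]: among the n lowest digits, they
    change only those of index at least a - 1 in the base b i, and none in the
    other bases. *)
Lemma chinese_shift (b : nat -> nat) (s n : nat) :
  (forall i j, i != j -> coprime (b i) (b j)) ->
  exists c : nat -> nat -> nat, forall i a, (i < s)%N ->
    (forall j, (j < s)%N -> j != i -> b j ^ n %| c i a)%N /\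
    c i a = b i ^ a.-1 %[mod b i ^ n].
Proof.
move=> co; pose Q i := (\prod_(j < s | j != i :> nat) b j ^ n)%N.
exists (fun i a => chinese (Q i) (b i ^ n) 0 (b i ^ a.-1))%N => i a si.
have coQ : coprime (Q i) (b i ^ n).
  rewrite coprime_sym.
  apply: (@coprime_prodr _ _ (fun j => b j ^ n)%N (fun j => j != i)) => j _ ji.
  by rewrite coprimeXl// coprimeXr// co// eq_sym.
split => [j js ji|]; last exact: chinese_modr.
apply: (@dvdn_trans (Q i)).
  by rewrite /Q (bigD1 (Ordinal js))//= dvdn_mulr.
by rewrite /dvdn chinese_modl// mod0n.
Qed.

Section window.
Variable R : realFieldType.

Lemma sum_ord_prefix (V : zmodType) (m k : nat) (f : nat -> V) :
  \sum_(i < m + k) f i = \sum_(i < m) f i + \sum_(i < k) f (m + i)%N.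
Proof. by rewrite big_split_ord. Qed.

(** Each block of A consecutive integers contains at most one point of the
    support of f. *)
Lemma sum_norm_window (f : nat -> R) (A C m v : nat) : (0 < A)%N ->
  (forall k, `|f k| <= 1) ->
  (forall k k', f k != 0 -> f k' != 0 -> k = k' %[mod A]) ->
  (m <= C * A)%N -> \sum_(k < m) `|f (v + k)%N| <= C%:R.
Proof.
move=> A0 f1 fA mC; apply: (@le_trans _ _ (\sum_(k < C * A) `|f (v + k)%N|)).
  rewrite -(subnKC mC) (sum_ord_prefix _ _ (fun k => `|f (v + k)%N|)) lerDl.
  by apply: sumr_ge0.
elim: C v {m mC} => [|C IH] v; first by rewrite mul0n big_ord0.
rewrite mulSn (sum_ord_prefix _ _ (fun k => `|f (v + k)%N|)).
rewrite -natr1 addrC; apply: lerD.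
  by under eq_bigr do rewrite addnA; exact: IH.
have [k0 k0n|all0] := pickP [pred k : 'I_A | f (v + k)%N != 0]; last first.
  by rewrite big1// => k _; have /negbFE/eqP -> := all0 k; rewrite normr0.
rewrite (bigD1 k0)//= big1 ?addr0// => k /eqP kk0.
apply/eqP; rewrite normr_eq0; apply/negPn/negP => fk; apply: kk0; apply: val_inj.
have := fA _ _ fk k0n => /eqP; rewrite eqn_modDl => /eqP.
by rewrite !modn_small.
Qed.

Lemma periodic_window (V : zmodType) (f : nat -> V) (A m v : nat) : periodic A f ->
  \sum_(k < A) f k = 0 ->
  \sum_(k < m) f (v + k)%N = \sum_(k < m %% A) f (v + k)%N.
Proof.
move=> fA f0.
have -> : \sum_(k < m) f (v + k)%N = \sum_(k < m %/ A * A + m %% A) f (v + k)%N.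
  by rewrite -divn_eq.
elim: (m %/ A)%N => [|q IH].
  by rewrite mul0n add0n.
rewrite mulSn -addnA (sum_ord_prefix _ _ (fun k => f (v + k)%N)) -[RHS]IH.
under eq_bigr do rewrite addnC.
rewrite periodic_sum_shift// f0 add0r; apply: eq_bigr => k _.
by rewrite addnCA addnC fA.
Qed.

Lemma norm_prodB (s : nat) (F G : nat -> R) :
  (forall i, 0 <= F i <= 1) -> (forall i, 0 <= G i <= 1) ->
  `|\prod_(i < s) F i - \prod_(i < s) G i| <= \sum_(i < s) `|F i - G i|.
Proof.
move=> F1 G1; elim: s => [|s IH]; first by rewrite !big_ord0 subrr normr0.
rewrite !big_ord_recr /=.
set p := \prod_(i < s) F i; set r := \prod_(i < s) G i.
have -> : p * F s - r * G s = (p - r) * F s + r * (F s - G s) by ring.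
apply: le_trans (ler_normD _ _) _; rewrite !normrM; apply: lerD.
  apply: le_trans IH; rewrite ler_piMr//; have /andP[? ?] := F1 s.
  by rewrite ger0_norm.
rewrite ler_piMl// ger0_norm; last by apply: prodr_ge0 => i _; case/andP: (G1 i).
by apply: prodr_ile1 => i _.
Qed.

End window.

Section halton.
Variables (R : realFieldType) (s n : nat) (b : nat -> nat) (x : nat -> R).
Hypothesis b1 : forall i, (1 < b i)%N.
Hypothesis co : forall i j, i != j -> coprime (b i) (b j).
Hypothesis x01 : forall i, 0 <= x i <= 1.

Let b0 i : (0 < b i)%N. Proof. exact: ltnW. Qed.

Let incr i j k := interval_increment (b i) (x i) j k.

Definition increment_product (l : seq 'I_n.+1) (k : nat) : R :=
  \prod_(i < s) interval_increment (b i) (x i) (nth ord0 l i) k.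

Let g := increment_product.

Lemma interval_increment_periodic i j m : (b i ^ j %| m)%N ->
  periodic m (interval_increment (b i) (x i) j).
Proof.
by move=> /dvdnP[q ->] k; apply: interval_increment_mod => //; rewrite addnC modnMDl.
Qed.

Lemma increment_product_periodic l m :
  (forall i, (i < s)%N -> b i ^ nth ord0 l i %| m)%N -> periodic m (g l).
Proof.
by move=> lm k; apply: eq_bigr => i _; apply: interval_increment_periodic; exact: lm.
Qed.

Lemma increment_product_norm l k : `|g l k| <= 1.
Proof.
rewrite normr_prod; apply: prodr_ile1 => i _.
by rewrite normr_ge0 interval_increment_norm.
Qed.

Lemma increment_product_support l k k' : g l k != 0 -> g l k' != 0 ->
  k = k' %[mod \prod_(i < s) b i ^ (nth ord0 l i).-1].
Proof.
move=> gk gk'.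
apply: (@eqmod_prod _ (fun i => b i ^ (nth ord0 l i).-1)%N) => [i j ij|i si].
  by rewrite coprimeXl// coprimeXr// co.
move/prodf_neq0 : gk => /(_ (Ordinal si) isT) /=.
move/prodf_neq0 : gk' => /(_ (Ordinal si) isT) /=.
case: (nat_of_ord (nth ord0 l i)) => [|j]; first by rewrite !modn1.
by move=> gk' gk; exact: interval_increment_support gk gk'.
Qed.

Lemma increment_product_shift_sum l i c t : (i < s)%N -> (0 < nth ord0 l i)%N ->
  (forall j, (j < s)%N -> j != i -> b j ^ n %| c)%N ->
  c = b i ^ (nth ord0 l i).-1 %[mod b i ^ n] ->
  \sum_(e < b i) g l (t + e * c)%N = 0.
Proof.
move=> si li cj ci.
rewrite (eq_bigr (fun e : 'I_(b i) =>
   incr i (nth ord0 l i) (t + e * b i ^ (nth ord0 l i).-1) *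
   \prod_(j < s | j != Ordinal si) incr j (nth ord0 l j) t)).
  rewrite -mulr_suml; move: li; rewrite /incr.
  by case: (nat_of_ord (nth ord0 l i)) => // j _; rewrite interval_increment_sum0 ?mul0r.
have lin j : (nth ord0 l j <= n)%N by rewrite -ltnS.
move=> e _; rewrite /g /increment_product (bigD1 (Ordinal si))//=; congr (_ * _).
  apply: interval_increment_mod => //.
  have /dvdn_exp2l dv := lin i.
  apply/eqP; rewrite eqn_modDl -modnMmr -(modn_dvdm c (dv (b i))) ci.
  by rewrite modn_dvdm// modnMmr.
apply: eq_bigr => j ji; apply: interval_increment_periodic.
by rewrite dvdn_mull// (dvdn_trans (dvdn_exp2l _ (lin j)))// cj.
Qed.

Lemma increment_product_sum0 l i A : (i < s)%N -> (0 < nth ord0 l i)%N ->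
  periodic A (g l) -> \sum_(k < A) g l k = 0.
Proof.
move=> si li gA; have [c /(_ i (nth ord0 l i) si)[cj ci]] := chinese_shift s n co.
have : \sum_(e < b i) \sum_(k < A) g l (k + e * c i (nth ord0 l i))%N = 0.
  rewrite exchange_big /= big1// => k _.
  exact: increment_product_shift_sum.
under eq_bigr do rewrite periodic_sum_shift//.
rewrite sumr_const card_ord => /eqP; rewrite mulrn_eq0 => /orP[/eqP bi0|/eqP //].
by have := b0 i; rewrite bi0.
Qed.

(** The sum over a full period vanishes, so only an incomplete period counts.
    The period is at most prod_i b_i times the modulus of the residue class
    that carries the support. *)
Lemma increment_product_window l i m t : (i < s)%N -> (0 < nth ord0 l i)%N ->
  `|\sum_(k < m) g l (t + k)%N| <= (\prod_(i < s) b i)%:R.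
Proof.
move=> si li; pose A := (\prod_(i < s) b i ^ nth ord0 l i)%N.
have A0 : (0 < A)%N by apply: prodn_gt0 => j; rewrite expn_gt0 b0.
have gA : periodic A (g l).
  apply: increment_product_periodic => j js.
  by rewrite /A (bigD1 (Ordinal js))//= dvdn_mulr.
rewrite (periodic_window _ _ gA (increment_product_sum0 si li gA)).
apply: le_trans (ler_norm_sum _ _ _) _.
apply: (sum_norm_window _ _ (@increment_product_norm l) (@increment_product_support l)).
  by apply: prodn_gt0 => j; rewrite expn_gt0 b0.
rewrite (leq_trans (ltnW (ltn_pmod _ A0)))// -big_split /= /A.
apply: leq_prod => j _; rewrite -expnS leq_exp2l//; exact: leqSpred.
Qed.

(** The product of increments of level zero is the constant prod_i x_i, which
    is what the discrepancy subtracts; its term is therefore set to zero. *)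
Definition level_term (m : nat) (l : seq 'I_n.+1) (t : nat) : R :=
  if all (pred1 ord0) l then 0 else \sum_(k < m) g l (t + k)%N.

(** The discrepancy at a point x with the indicators of [0, x_i) replaced by the
    martingales of level n, and with the number m of counted terms in place of
    N times the first coordinate. *)
Definition smoothed_discrepancy (m t : nat) : R :=
  \sum_(k < m) \prod_(i < s) interval_density (b i) (x i) n (t + k)%N
  - m%:R * \prod_(i < s) x i.

Lemma smoothed_discrepancyE m t :
  smoothed_discrepancy m t = level_sum s (level_term m ^~ t).
Proof.
apply/eqP; rewrite subr_eq; apply/eqP.
rewrite -[X in _ = _ + X](level_sum_delta n s) -level_sumD.
transitivity (level_sum s (fun l => \sum_(k < m) g l (t + k)%N)).
  rewrite -(exchange_level_sum _ _ (fun l (k : 'I_m) => g l (t + k)%N)).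
  apply: eq_bigr => k _.
  rewrite (level_sum_prod s (fun i a => interval_increment (b i) (x i) a (t + k)%N)).
  by apply: eq_bigr => i _; rewrite sum_interval_increment.
apply: eq_level_sum => l ls; rewrite /level_term.
case: ifP => [/allP l0|_]; last by rewrite addr0.
rewrite add0r (eq_bigr (fun=> \prod_(i < s) x i)); last first.
  move=> k _; apply: eq_bigr => i _.
  by have /eqP -> : nth ord0 l i == ord0 by apply: l0; rewrite mem_nth// ls.
by rewrite sumr_const card_ord mulr_natl.
Qed.

Lemma level_term_norm m l t : size l = s ->
  `|level_term m l t| <= (\prod_(i < s) b i)%:R.
Proof.
move=> ls; rewrite /level_term; case: ifP => [_|/negbT]; first by rewrite normr0 ler0n.
rewrite -has_predC => /(has_nthP ord0)[i]; rewrite ls => si /= li.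
by apply: (increment_product_window _ _ si); rewrite lt0n.
Qed.

Lemma smoothed_discrepancy_norm m t :
  `|smoothed_discrepancy m t| <= n.+1%:R ^+ s * (\prod_(i < s) b i)%:R.
Proof.
rewrite smoothed_discrepancyE; apply: level_sum_norm => l ls; exact: level_term_norm.
Qed.

Lemma smoothed_discrepancy_moment m q (P := (\prod_(i < s) b i ^ n)%N) :
  \sum_(t < P) smoothed_discrepancy m t ^+ (2 * q.+1) <=
  ((4 * q.+1 * n.+1)%:R ^+ q.+1) ^+ s * (P%:R * (\prod_(i < s) b i)%:R ^+ (2 * q.+1)).
Proof.
under eq_bigr do rewrite smoothed_discrepancyE.
have lin (l : seq 'I_n.+1) j : (nth ord0 l j <= n)%N by rewrite -ltnS ltn_ord.
have [c cP] := chinese_shift s n co.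
have term_periodic l p : periodic p (g l) -> periodic p (level_term m l).
  move=> gp t; rewrite /level_term; case: ifP => // _.
  by apply: eq_bigr => k _; rewrite addnAC gp.
apply: (@level_sum_moment _ _ _ _ _ b c) => //.
- move=> l ls; apply/term_periodic/increment_product_periodic => i si.
  rewrite (dvdn_trans (dvdn_exp2l _ (lin l i)))// /P (bigD1 (Ordinal si))//=.
  exact: dvdn_mulr.
- move=> l i a ls si /andP[la an]; apply/term_periodic/increment_product_periodic => j js.
  have [cj ci] := cP i a si; have [->|ji] := eqVneq j i.
    rewrite /dvdn -(modn_dvdm _ (dvdn_exp2l (b i) (lin l i))) ci modn_dvdm ?dvdn_exp2l//.
    by apply: dvdn_exp2l; rewrite -ltnS prednK// (leq_trans _ la).
  by rewrite (dvdn_trans (dvdn_exp2l _ (lin l j)))// cj.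
- move=> l i t ls si li; have [cj ci] := cP i (nth ord0 l i) si.
  rewrite /level_term; case: (all _ l); first by rewrite big1.
  rewrite exchange_big /= big1// => k _.
  rewrite -[RHS](increment_product_shift_sum (t + k)%N si li cj ci).
  by apply: eq_bigr => e _; rewrite addnAC.
- move=> l t ls; exact: level_term_norm.
Qed.

(** As m <= 2^n <= b_i^n, in each coordinate at most one of the m consecutive
    integers falls into the interval where the martingale and the indicator
    differ. *)
Lemma indicator_error_sum m t : (m <= 2 ^ n)%N ->
  `|\sum_(k < m) \prod_(i < s)
      ((radical_inverse (b i) n (t + k))%:R / (b i)%:R ^+ n < x i)%R%:R
    - \sum_(k < m) \prod_(i < s) interval_density (b i) (x i) n (t + k)%N| <= s%:R.
Proof.
move=> m2; rewrite -sumrB; apply: le_trans (ler_norm_sum _ _ _) _.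
apply: (@le_trans _ _ (\sum_(k < m) \sum_(i < s)
    `|indicator_error (b i) (x i) n (t + k)%N|)).
  apply: ler_sum => k _.
  apply: (@norm_prodB _ s
     (fun i => ((radical_inverse (b i) n (t + k))%:R / (b i)%:R ^+ n < x i)%R%:R)
     (fun i => interval_density (b i) (x i) n (t + k)%N)) => i.
    by case: (_ < _); rewrite ?lexx ler01.
  exact: interval_density01.
rewrite exchange_big /=.
apply: (@le_trans _ _ (\sum_(i < s) 1)); last by rewrite sumr_const card_ord.
apply: ler_sum => i _; apply: (@sum_norm_window _ _ (b i ^ n) 1) => //.
- by rewrite expn_gt0 b0.
- move=> k; rewrite /indicator_error.
  have /andP[d0 d1] := interval_density01 (b i) n k (x i).
  by rewrite ler_norml; case: (_ < _) => /=; lra.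
- by move=> k k'; exact: indicator_error_support.
- by rewrite mul1n (leq_trans m2)//; case: (n) => // n'; rewrite leq_exp2r.
Qed.

End halton.

(** * From moments to exponential integrability *)

Lemma pow_self_le_fact (R : realType) (m : nat) : m%:R ^+ m <= expR 1 ^+ m * m`!%:R :> R.
Proof.
case: m => [|m]; first by rewrite !expr0 mulr1.
have := expR_ge1Dxn m (ler0n R m.+1).
have -> : expR m.+1%:R = expR 1 ^+ m.+1 :> R by rewrite -expRM_natl mulr1.
rewrite -ler_pdivrMr ?ltr0n ?fact_gt0//.
by apply: le_trans; rewrite lerDr.
Qed.

Lemma sum_half_pow (R : realFieldType) (N : nat) : \sum_(i < N) (2^-1 : R) ^+ i <= 2.
Proof.
suff -> : \sum_(i < N) (2^-1 : R) ^+ i = 2 - 2 * 2^-1 ^+ N.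
  by rewrite gerBl mulr_ge0// exprn_ge0// invr_ge0.
elim: N => [|N IH]; first by rewrite big_ord0 expr0 mulr1 subrr.
by rewrite big_ord_recr /= IH exprS; lra.
Qed.

(** Termwise in the exponential series: m^m <= e^m m! bounds the average of the
    m-th term by 2^-m. *)
Lemma exp_moment (R : realType) (P : nat) (Z : nat -> R) (C : R) : 0 < C ->
  (forall m, \sum_(t < P) Z t ^+ m <= P%:R * (C * m%:R) ^+ m) ->
  \sum_(t < P) expR (Z t / (2 * expR 1 * C)) <= P%:R * 2.
Proof.
move=> C0 Zm; set k := 2 * expR 1 * C.
have e0 : 0 < expR 1 :> R by exact: expR_gt0.
have k0 : 0 < k by rewrite !mulr_gt0.
pose u N : R := \sum_(t < P) series (exp_coeff (Z t / k)) N.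
have uE : u @ \oo --> \sum_(t < P) expR (Z t / k).
  rewrite /u; apply: cvg_big => [|t _]; first exact: add_continuous.
  exact: is_cvg_series_exp_coeff.
apply: (cvgr_to_le uE); apply: nearW => N.
rewrite /u /series /= exchange_big /=.
rewrite big_mkord; apply: le_trans (ler_wpM2l (ler0n _ P) (sum_half_pow R N)).
rewrite mulr_sumr; apply: ler_sum => m _; rewrite /exp_coeff /=.
under eq_bigr do rewrite expr_div_n.
rewrite -!mulr_suml.
have km : 0 < k ^+ m by rewrite exprn_gt0.
have fm : 0 < m`!%:R :> R by rewrite ltr0n fact_gt0.
rewrite ler_pdivrMr// ler_pdivrMr//; apply: le_trans (Zm m) _.
rewrite -!mulrA ler_wpM2l ?ler0n// exprMn.
have := ler_wpM2l (exprn_ge0 m (ltW C0)) (pow_self_le_fact R m).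
move/le_trans; apply; rewrite le_eqVlt; apply/orP; left; apply/eqP.
rewrite /k !exprMn exprVn; field.
by rewrite expf_neq0.
Qed.

(** Jensen in the form of the tangent inequality at 1, applied to Z / a. *)
Lemma moment_root (R : realFieldType) (P s : nat) (Z : nat -> R) (a : R) :
  0 < a -> (forall t, 0 <= Z t) ->
  \sum_(t < P) Z t ^+ s.+1 <= P%:R * a ^+ s.+1 -> \sum_(t < P) Z t <= P%:R * a.
Proof.
move=> a0 Z0 ZP.
have tang t : s.+1%:R * (Z t / a - 1) <= (Z t / a) ^+ s.+1 - 1.
  have := @exprn_tangent _ s 1 (Z t / a) ler01 (divr_ge0 (Z0 t) (ltW a0)).
  by rewrite !expr1n mulr1 addrC -lerBrDr.
have : \sum_(t < P) s.+1%:R * (Z t / a - 1) <= 0.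
  apply: (@le_trans _ _ (\sum_(t < P) ((Z t / a) ^+ s.+1 - 1))).
    by apply: ler_sum => t _; exact: tang.
  rewrite sumrB sumr_const card_ord subr_le0.
  under eq_bigr do rewrite expr_div_n.
  by rewrite -mulr_suml ler_pdivrMr ?exprn_gt0.
rewrite -mulr_sumr pmulr_rle0 ?ltr0n// sumrB sumr_const card_ord subr_le0.
by rewrite -mulr_suml ler_pdivrMr.
Qed.

(** Interpolation between the supremum and the moments.  With
    v = |D| / (B1 L^s) <= 1, the exponent is v^beta L / (32 e), which is at
    most Z / (32 e) for Z = v^(2/s) L.  Since Z^s = D^2 / (B1^2 L^s), Jensen
    bounds the m-th moment of Z by the s-th root of the normalised 2m-th moment
    of D, that is by (16 m)^m. *)
Lemma exp_chaos_bound (R : realType) (P s : nat) (L B1 beta : R) (D : nat -> R) :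
  (0 < s)%N -> 1 <= L -> 0 < B1 -> 2 / s%:R <= beta ->
  (forall t, `|D t| <= B1 * L ^+ s) ->
  (forall m, \sum_(t < P) D t ^+ (2 * m) <=
     P%:R * ((16 * m%:R) ^+ m) ^+ s * (B1 ^+ 2 * L ^+ s) ^+ m) ->
  \sum_(t < P)
     expR ((`|D t| / ((32 * expR 1) `^ beta^-1 * B1 * L `^ (s%:R - beta^-1))) `^ beta)
   <= P%:R * 2.
Proof.
move=> s0 L1 B10 sb DB Dm.
have L0 : 0 < L by apply: lt_le_trans L1.
have s0' : 0 < s%:R :> R by rewrite ltr0n.
have beta0 : 0 < beta by apply: lt_le_trans sb; rewrite divr_gt0.
have Ls0 : 0 < L ^+ s by rewrite exprn_gt0.
have e0 : 0 < 32 * expR 1 :> R by rewrite mulr_gt0// expR_gt0.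
pose v t := `|D t| / (B1 * L ^+ s).
have v0 t : 0 <= v t by rewrite divr_ge0// mulr_ge0// ltW.
have v1 t : v t <= 1 by rewrite ler_pdivrMr ?mulr_gt0// mul1r.
pose Z t := v t `^ (2 / s%:R) * L.
have Z0 t : 0 <= Z t by rewrite mulr_ge0 ?powR_ge0// ltW.
have ZE t : Z t ^+ s = D t ^+ 2 / (B1 ^+ 2 * L ^+ s).
  rewrite /Z exprMn -(powR_mulrn s (powR_ge0 _ _)) -powRrM divfK ?gt_eqF//.
  rewrite (powR_mulrn 2 (v0 t)).
  rewrite /v expr_div_n real_normK ?num_real//; field.
  by rewrite !gt_eqF.
have Zm m : \sum_(t < P) Z t ^+ m <= P%:R * (16 * m%:R) ^+ m.
  case: m => [|m]; first by rewrite !expr0 mulr1 sumr_const card_ord.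
  apply: (@moment_root _ _ s.-1 (fun t => Z t ^+ m.+1)).
  - by rewrite exprn_gt0// mulr_gt0// ltr0n.
  - by move=> t; rewrite exprn_ge0.
  - rewrite prednK//; under eq_bigr do rewrite exprAC ZE expr_div_n -exprM.
    by rewrite -mulr_suml ler_pdivrMr ?exprn_gt0 ?mulr_gt0 ?exprn_gt0.
have := @exp_moment _ P Z 16 _ Zm; rewrite ltr0n => /(_ isT).
have -> : 2 * expR 1 * 16 = 32 * expR 1 :> R by ring.
apply: le_trans; apply: ler_sum => t _; rewrite ler_expR.
have -> : `|D t| / ((32 * expR 1) `^ beta^-1 * B1 * L `^ (s%:R - beta^-1)) =
    v t * L `^ beta^-1 / (32 * expR 1) `^ beta^-1.
  have -> : L `^ (s%:R - beta^-1) = L ^+ s / L `^ beta^-1.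
    by rewrite powRB ?(powR_mulrn s (ltW L0))//; apply/implyP => _; rewrite gt_eqF.
  rewrite /v; field.
  by rewrite !gt_eqF ?powR_gt0.
have bn0 : beta != 0 by rewrite gt_eqF.
move: (32 * expR 1) e0 => E E0.
have vL : 0 <= v t * L `^ beta^-1 by rewrite mulr_ge0 ?powR_ge0.
rewrite -powRN (powRM _ vL (powR_ge0 _ _)) (powRM _ (v0 t) (powR_ge0 _ _)).
rewrite -!powRrM mulNr mulVf// (powRr1 (ltW L0)) (powR_inv1 (ltW E0)).
rewrite ler_pM2r ?invr_gt0// /Z ler_pM2r//.
have [->|vt0] := eqVneq (v t) 0.
  by rewrite !powR0// gt_eqF// divr_gt0.
by apply: ger_powR => //; rewrite v1 lt_neqAle eq_sym vt0 v0.
Qed.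

(** * Shifted Halton point sets *)

(** The first coordinate of the points only selects how many terms of the
    sequence are counted. *)
Lemma grid_count (R : archiRealFieldType) (N : nat) (y : R) : 0 <= y <= 1 -> (0 < N)%N ->
  exists m : nat, [/\ (m <= N)%N, `|m%:R - N%:R * y| <= 1 &
    forall k : nat, (k%:R / N%:R < y) = (k < m)%N].
Proof.
move=> /andP[y0 y1] N0; have N0' : 0 < N%:R :> R by rewrite ltr0n.
have yN : exists m : nat, N%:R * y <= m%:R by exists N; rewrite ler_piMr// ltW.
have [m ym mmin] := ex_minnP yN.
have lt_m k : (N%:R * y <= k%:R) = (m <= k)%N.
  apply/idP/idP => [/mmin //|mk]; apply: le_trans ym _.
  by rewrite ler_nat.
exists m; split.
- by apply: mmin; rewrite ler_piMr// ltW.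
- rewrite ger0_norm ?subr_ge0// lerBlDr; case: m {ym mmin} lt_m => [|m] lt_m.
    by rewrite addr_ge0// mulr_ge0// ltW.
  by rewrite -natr1 addrC lerD2l ltW// ltNge lt_m ltnn.
- by move=> k; rewrite ltr_pdivrMr// mulrC ltNge lt_m ltnNge.
Qed.

(** A sequence of pairwise coprime bases: each term is 1 modulo all the
    earlier ones. *)
Fixpoint sylvester (i : nat) : nat :=
  if i is j.+1 then (sylvester j * (sylvester j).-1).+1 else 2.

Lemma sylvester_gt1 i : (1 < sylvester i)%N.
Proof. by elim: i => //= i IH; rewrite ltnS muln_gt0; lia. Qed.

Lemma sylvester_coprime i j : i != j -> coprime (sylvester i) (sylvester j).
Proof.
wlog ij : i j / (i < j)%N => [hw|_].
  rewrite neq_ltn => /orP[?|?]; [|rewrite coprime_sym];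
  by apply: hw; rewrite ?ltn_eqF.
suff /dvdnP[q qE] : (sylvester i %| (sylvester j).-1)%N.
  have -> : sylvester j = (q * sylvester i + 1)%N.
    by rewrite -qE addn1 prednK// ltnW// sylvester_gt1.
  by rewrite /coprime gcdnMDl gcdn1.
elim: j ij => // j IH; rewrite ltnS leq_eqVlt => /orP[/eqP <-|/IH ij] /=.
  exact: dvdn_mulr.
exact: dvdn_mull.
Qed.

Lemma anchored_box_indic (R : realType) (d : nat) (x z : d.-tuple R) :
  (forall i, 0 <= tnth z i) ->
  \1_(anchored_box x) z = \prod_(i < d) (tnth z i < tnth x i)%R%:R :> R.
Proof.
move=> z0; rewrite indicE; have [zx|/negP zx] := boolP (z \in anchored_box x).
  rewrite big1// => i _; move: zx; rewrite inE => /(_ i) /=.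
  by rewrite in_itv /= => /andP[_ ->].
have [i zi] : exists i, ~~ (tnth z i < tnth x i).
  apply: contrapT => nz; apply: zx; rewrite inE => i /=; rewrite in_itv /= z0 /=.
  by apply: contrapT => /negP zi; apply: nz; exists i.
by rewrite (bigD1 i)//= (negbTE zi) mul0r.
Qed.

Lemma unit_cube_coord (R : realType) (s : nat) (x : s.+1.-tuple R) (i : nat) :
  unit_cube s.+1 x -> 0 <= nth 0 x i.+1 <= 1.
Proof.
move=> xc; case: (ltnP i.+1 s.+1) => is1; last first.
  by rewrite nth_default ?size_tuple ?lexx ?ler01.
by have := xc (Ordinal is1); rewrite /= in_itv /= (tnth_nth 0) /= => /andP[-> /ltW ->].
Qed.

Section points.
Variables (R : realType) (s N n : nat).
Let b := sylvester.

Definition halton_point (t k : nat) : s.+1.-tuple R :=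
  [tuple of k%:R / N%:R ::
    mktuple (fun i : 'I_s => (radical_inverse (b i) n (t + k))%:R / (b i)%:R ^+ n)].

Definition halton_set (t : nat) : {fset s.+1.-tuple R} :=
  [fset z in [seq halton_point t k | k <- iota 0 N]]%fset.

Hypothesis N0 : (0 < N)%N.
Let N0' : 0 < N%:R :> R. Proof. by rewrite ltr0n. Qed.

Lemma halton_point_inj t : injective (halton_point t).
Proof.
move=> k k' /(congr1 (fun z => tnth z ord0)); rewrite !(tnth_nth 0) /=.
by move=> /(mulIf (invr_neq0 (lt0r_neq0 N0'))) /eqP; rewrite eqr_nat => /eqP.
Qed.

Lemma halton_set_perm t :
  perm_eq (halton_set t) [seq halton_point t k | k <- iota 0 N].
Proof.
apply: uniq_perm; first exact: fset_uniq.
  by rewrite map_inj_uniq ?iota_uniq//; exact: halton_point_inj.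
by move=> z; rewrite !inE.
Qed.

Lemma card_halton_set t : #|` halton_set t|%fset = N.
Proof. by rewrite (perm_size (halton_set_perm t)) size_map size_iota. Qed.

Lemma halton_set_cube t : [set` halton_set t] `<=` unit_cube s.+1.
Proof.
move=> z /=; rewrite (perm_mem (halton_set_perm t)) => /mapP[k].
rewrite mem_iota add0n => /andP[_ kN] -> i /=; rewrite in_itv /=.
have [j ->|->] := unliftP ord0 i.
  have bn : 0 < (b j)%:R ^+ n :> R by rewrite exprn_gt0// ltr0n ltnW// sylvester_gt1.
  rewrite tnthS tnth_mktuple divr_ge0 ?(ltW bn)//= ltr_pdivrMr// mul1r -natrX ltr_nat.
  by rewrite radical_inverse_lt// ltnW// sylvester_gt1.
by rewrite (tnth_nth 0) /= divr_ge0//= ltr_pdivrMr// mul1r ltr_nat.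
Qed.

Let coord (x : s.+1.-tuple R) (i : nat) : R := nth 0 x i.+1.

(** The number m of counted terms depends on x but not on the shift t; this
    allows averaging over t. *)
Lemma discrepancy_halton x : unit_cube s.+1 x -> (N <= 2 ^ n)%N ->
  exists m, forall t, `|discrepancy (halton_set t) x -
    smoothed_discrepancy s n b (coord x) m t| <= s%:R + 1.
Proof.
move=> xc N2.
have x01 i : 0 <= coord x i <= 1 by exact: unit_cube_coord.
have y01 : 0 <= tnth x ord0 <= 1.
  by have := xc ord0; rewrite /= in_itv /= => /andP[-> /ltW ->].
have [m [mN mNy cnt]] := grid_count y01 N0; exists m => t.
rewrite /discrepancy card_halton_set (perm_big _ (halton_set_perm t)) /= big_map.
rewrite -[N in iota 0 N]subn0 -/(index_iota 0 N) big_mkord.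
have tx i : tnth x (lift ord0 i) = coord x i by rewrite (tnth_nth 0).
pose chi k : R := \prod_(i < s) ((radical_inverse (b i) n (t + k))%:R / (b i)%:R ^+ n
     < coord x i)%R%:R.
have -> : \sum_(k < N) \1_(anchored_box x) (halton_point t k) = \sum_(k < m) chi k.
  rewrite (big_ord_widen _ chi mN) [RHS]big_mkcond; apply: eq_bigr => k _.
  rewrite anchored_box_indic => [|i]; last first.
    have : [set` halton_set t] (halton_point t k).
      by rewrite /= (perm_mem (halton_set_perm t)) map_f// mem_iota add0n ltn_ord.
    by move/halton_set_cube/(_ i); rewrite /= in_itv /= => /andP[].
  rewrite big_ord_recl (tnth_nth 0 (halton_point t k)) /= cnt.
  case: (k < m)%N; last by rewrite mul0r.
  by rewrite mul1r; apply: eq_bigr => i _; rewrite tnthS tnth_mktuple tx.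
rewrite big_ord_recl /smoothed_discrepancy.
have -> : \prod_(i < s) tnth x (lift ord0 i) = \prod_(i < s) coord x i.
  by apply: eq_bigr => i _; rewrite tx.
have err := indicator_error_sum s (coord x) sylvester_gt1 t (leq_trans mN N2).
set S1 := \sum_(k < m) chi k; set S2 := \sum_(k < m) _.
set p := \prod_(i < s) coord x i.
have -> : S1 - N%:R * (tnth x ord0 * p) - (S2 - m%:R * p) =
  (S1 - S2) + (m%:R - N%:R * tnth x ord0) * p by ring.
apply: le_trans (ler_normD _ _) _; apply: lerD; first exact: err.
rewrite normrM; apply: mulr_ile1 => //.
rewrite ger0_norm; last by apply: prodr_ge0 => i _; case/andP: (x01 i).
by apply: prodr_ile1 => i _.
Qed.

End points.

(** The error s + 1 made in passing to the smoothed discrepancy costs a factor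
    4^m in the 2m-th moment, hence 16 m in place of the 4 m of
    [smoothed_discrepancy_moment]; B1 bounds both contributions. *)
Lemma discrepancy_exp_bound (R : realType) (s N n : nat) (beta : R) (x : s.+1.-tuple R)
    (P := (\prod_(i < s) sylvester i ^ n)%N)
    (B1 := (\prod_(i < s) sylvester i)%:R + s%:R + 1) :
  (0 < s)%N -> (0 < N)%N -> (N <= 2 ^ n)%N -> 2 / s%:R <= beta -> unit_cube s.+1 x ->
  \sum_(t < P) expR ((`|discrepancy (halton_set R s N n t) x| /
     ((32 * expR 1) `^ beta^-1 * B1 * n.+1%:R `^ (s%:R - beta^-1))) `^ beta) <= P%:R * 2.
Proof.
move=> s0 N0 N2 sb xc.
pose B : R := (\prod_(i < s) sylvester i)%:R.
have B0 : 0 <= B by rewrite ler0n.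
have sR0 : 0 <= s%:R :> R by rewrite ler0n.
have B10 : 0 < B1 by rewrite /B1 -/B; lra.
pose L : R := n.+1%:R; have L1 : 1 <= L by rewrite ler1n.
have Ls1 : 1 <= L ^+ s by rewrite exprn_ege1.
have x01 i : 0 <= nth 0 x i.+1 <= 1 by exact: unit_cube_coord.
have [m Dm] := discrepancy_halton N0 xc N2.
pose D t := discrepancy (halton_set R s N n t) x.
pose delta t := smoothed_discrepancy s n sylvester (fun i => nth 0 x i.+1) m t.
pose e : R := s%:R + 1.
have {}Dm t : `|D t - delta t| <= e := Dm t.
have BL : 0 <= L ^+ s * B by rewrite mulr_ge0// exprn_ge0// (le_trans ler01).
have dB t : `|delta t| <= L ^+ s * B.
  exact: (smoothed_discrepancy_norm s n sylvester_gt1 sylvester_coprime x01).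
apply: (@exp_chaos_bound _ P s L B1 beta D) => // [t|[|q]].
- have := ler_normD (delta t) (D t - delta t); rewrite addrC subrK => /le_trans; apply.
  apply: le_trans (lerD (dB t) (Dm t)) _.
  by rewrite /B1 -/B -addrA mulrDl mulrC lerD2l ler_peMr// /e addr_ge0.
- by rewrite (eq_bigr (fun=> 1)) ?sumr_const ?card_ord// !expr0 expr1n !mulr1.
pose X : R := ((4 * q.+1 * n.+1)%:R ^+ q.+1) ^+ s.
have dM : \sum_(t < P) delta t ^+ (2 * q.+1) <= X * (P%:R * B ^+ (2 * q.+1)).
  exact: (smoothed_discrepancy_moment s n sylvester_gt1 sylvester_coprime x01).
have X1 : 1 <= X by rewrite /X !exprn_ege1// ler1n.
have DM t : D t ^+ (2 * q.+1) <=
    2^-1 * 4 ^+ q.+1 * (delta t ^+ (2 * q.+1) + e ^+ (2 * q.+1)).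
  have := exprD_moment q (delta t) (D t - delta t).
  rewrite addrC subrK => /le_trans; apply.
  rewrite ler_wpM2l ?mulr_ge0 ?invr_ge0 ?exprn_ge0// lerD2l.
  rewrite !exprM lerXn2r ?nnegrE ?sqr_ge0// -[leLHS]real_normK ?num_real//.
  by rewrite lerXn2r ?nnegrE// (le_trans _ (Dm t)).
apply: (@le_trans _ _ (\sum_(t < P)
    2^-1 * 4 ^+ q.+1 * (delta t ^+ (2 * q.+1) + e ^+ (2 * q.+1)))).
  by apply: ler_sum => t _; exact: DM.
rewrite -mulr_sumr big_split /= sumr_const card_ord -[_ *+ P]mulr_natl.
have BB : B ^+ (2 * q.+1) <= B1 ^+ (2 * q.+1).
  by rewrite lerXn2r ?nnegrE ?(ltW B10)// /B1 -/B; lra.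
have eB : e ^+ (2 * q.+1) <= B1 ^+ (2 * q.+1).
  by rewrite lerXn2r ?nnegrE ?(ltW B10)// /B1 -/B /e; lra.
have P0 : 0 <= P%:R :> R by rewrite ler0n.
have B1q : 0 <= B1 ^+ (2 * q.+1) by rewrite exprn_ge0// ltW.
have s1 : X * (P%:R * B ^+ (2 * q.+1)) <= X * (P%:R * B1 ^+ (2 * q.+1)).
  by rewrite ler_wpM2l ?(le_trans ler01)// ler_wpM2l.
have s2 : P%:R * e ^+ (2 * q.+1) <= X * (P%:R * B1 ^+ (2 * q.+1)).
  apply: (@le_trans _ _ (P%:R * B1 ^+ (2 * q.+1))); first by rewrite ler_wpM2l.
  by rewrite ler_peMl// mulr_ge0.
apply: (@le_trans _ _ (2^-1 * 4 ^+ q.+1 * (2 * (X * (P%:R * B1 ^+ (2 * q.+1)))))).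
  by apply: ler_wpM2l; [rewrite mulr_ge0 ?invr_ge0 ?exprn_ge0|lra].
have -> : P%:R * (16 * q.+1%:R) ^+ q.+1 ^+ s * (B1 ^+ 2 * L ^+ s) ^+ q.+1 =
    (4 ^+ q.+1) ^+ s * (X * (P%:R * B1 ^+ (2 * q.+1))).
  have -> : (B1 ^+ 2 * L ^+ s) ^+ q.+1 = B1 ^+ (2 * q.+1) * (L ^+ q.+1) ^+ s.
    by rewrite [LHS]exprMn -!exprM (mulnC s).
  have -> : 16 * q.+1%:R = 4 * (4 * q.+1%:R) :> R by ring.
  have -> : X = ((4 * q.+1%:R) ^+ q.+1) ^+ s * (L ^+ q.+1) ^+ s.
    by rewrite /X !natrM -/L [(_ * L) ^+ _]exprMn exprMn.
  by rewrite [(4 * (4 * _)) ^+ _]exprMn [(4 ^+ _ * _) ^+ s]exprMn; ring.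
have -> : 2^-1 * 4 ^+ q.+1 * (2 * (X * (P%:R * B1 ^+ (2 * q.+1)))) =
    4 ^+ q.+1 * (X * (P%:R * B1 ^+ (2 * q.+1))) by field.
rewrite ler_wpM2r ?mulr_ge0 ?(le_trans ler01 X1)//.
by rewrite -[leLHS]expr1; apply: ler_weXn2l => //; rewrite exprn_ege1// ler1n.
Qed.

(** * Averaging the Orlicz integral over the shifts *)

(** Monotonicity for nonnegative functions that may fail to be measurable: the
    integral is a supremum over simple functions from below.  It is applied to
    a composition with an arbitrary Young function. *)
Lemma ge0_integral_mono d (T : measurableType d) (R : realType)
    (mu : {measure set T -> \bar R}) (D : set T) (f g : T -> \bar R) :
  (forall x, D x -> 0 <= f x)%E -> (forall x, D x -> f x <= g x)%E ->
  (\int[mu]_(x in D) f x <= \int[mu]_(x in D) g x)%E.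
Proof.
move=> f0 fg.
have g0 x : D x -> (0 <= g x)%E by move=> Dx; exact: le_trans (f0 x Dx) (fg x Dx).
rewrite !ge0_integralE//; apply: ereal_sup_le => _ [h /= hf <-]; exists h => //= x.
apply: le_trans (hf x) _; rewrite /patch; case: ifPn => // /set_mem; exact: fg.
Qed.

Lemma measurable_discrepancy (R : realType) (d : nat) (P : {fset d.-tuple R}) :
  measurable_fun [set: d.-tuple (measurableTypeR R)]
    (discrepancy P : d.-tuple (measurableTypeR R) -> measurableTypeR R).
Proof.
apply: measurable_funB.
  apply: measurable_sum => z.
  have -> : (fun x : d.-tuple R => \1_(anchored_box x) z : R) =
     \1_[set x : d.-tuple (measurableTypeR R) | forall i : 'I_d,
         [set y : measurableTypeR R | 0 <= tnth z i < y] (tnth x i)].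
    by apply/funext => x; rewrite !indicE; congr (_%:R).
  apply: measurable_indic.
  apply: (@measurable_tuple_box _ _ _
    (fun i : 'I_d => [set y : measurableTypeR R | 0 <= tnth z i < y])).
  move=> i; case: (boolP (0 <= tnth z i)) => zi.
    rewrite (_ : [set y | _] = `]tnth z i, +oo[%classic); first exact: measurable_itv.
    by apply/seteqP; split => y /=; rewrite in_itv /= andbT.
  rewrite (_ : [set y | _] = set0); first exact: measurable0.
  by apply/seteqP; split.
apply: measurable_funM; first exact: measurable_cst.
apply: measurable_prod => i _; exact: measurable_tnth.
Qed.

(** Convexity between 0 and y.  It turns a bound on the integral of psi by a
    constant into a bound by 1 at the price of that constant in the norm. *)
Lemma young_scale (R : realType) (psi : R -> R) (y C : R) :
  young_function psi -> 0 <= y -> 1 <= C -> psi (y / C) <= psi y / C.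
Proof.
move=> [p0 pc pz] y0 C1; have C0 : 0 < C by lra.
have t01 : 0 <= C^-1 <= 1 by rewrite invr_ge0 (ltW C0) invf_le1.
pose t : {i01 R} := Itv01 (proj1 (andP t01)) (proj2 (andP t01)).
have yD : y \in (`[0, +oo[%classic : set R) by rewrite inE /= in_itv /= y0.
have D0 : 0 \in (`[0, +oo[%classic : set R) by rewrite inE /= in_itv /= lexx.
have : psi (C^-1 * y + (1 - C^-1) * 0) <= C^-1 * psi y + (1 - C^-1) * psi 0.
  exact: (pc t y 0 yD D0).
rewrite mulr0 addr0 (pz 0 (lexx 0)).2// mulr0 addr0.
by rewrite ![C^-1 * _]mulrC.
Qed.

(** Below the threshold psi is bounded by its value there, because convexity and
    psi 0 = 0 make it nondecreasing. *)
Lemma exp_young_le (R : realType) (psi : R -> R) (beta : R) :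
  exp_young_function beta psi ->
  exists A : R, 0 <= A /\ forall y, 0 <= y -> psi y <= A + expR (y `^ beta).
Proof.
move=> [yp [r [_ psir]]]; have [p0 _ _] := yp.
pose M := Num.max r 0 + 1.
have M0 : 0 < M by rewrite ltr_pwDr// le_max lexx orbT.
have psiM y : M <= y -> psi y = expR (y `^ beta) - 1.
  by move=> My; apply: psir; apply: lt_le_trans My; rewrite ltr_pwDr// le_max lexx.
exists (psi M); split; first exact/p0/ltW.
move=> y y0; have [My|/ltW yM] := leP M y.
  by rewrite psiM// addrC lerD2r (le_trans _ (p0 M (ltW M0)))// lerN10.
suff pyM : psi y <= psi M by rewrite (le_trans pyM)// lerDl expR_ge0.
have [->|yn0] := eqVneq y 0.
  by have [_ _ pz] := yp; rewrite (pz 0 (lexx 0)).2 ?p0 ?ltW.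
have y0' : 0 < y by rewrite lt_neqAle eq_sym yn0.
have My1 : 1 <= M / y by rewrite ler_pdivlMr// mul1r.
have := young_scale yp (ltW M0) My1.
rewrite !invf_div mulrCA divff ?gt_eqF// mulr1; move/le_trans; apply.
by rewrite ler_piMr ?p0 ?(ltW M0)// ler_pdivrMr// mul1r.
Qed.

Lemma ereal_average_le (R : realType) (P : nat) (a : nat -> \bar R) : (0 < P)%N ->
  (forall t, 0 <= a t)%E -> (\sum_(t < P) a t <= P%:R%:E)%E ->
  exists t, (a t <= 1)%E.
Proof.
move=> P0 a0 aP; apply: contrapT => na.
have a1 t : (1 < a t)%E by rewrite ltNge; apply/negP => at1; apply: na; exists t.
have afin (t : 'I_P) : a t \is a fin_num.
  rewrite ge0_fin_numE//; apply: le_lt_trans (ltry P%:R); apply: le_trans aP.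
  by rewrite (bigD1 t)//= leeDl// sume_ge0.
have : (\sum_(t < P) (fine (a t))%:E <= P%:R%:E)%E.
  by under eq_bigr do rewrite fineK//.
rewrite sumEFin lee_fin leNgt => /negP; apply.
rewrite -[ltLHS]mulr1 -[ltLHS](_ : \sum_(t < P) 1 = _); last first.
  by rewrite sumr_const card_ord mulr_natl.
apply: ltr_sum => [|t _].
  by apply/hasP; exists (Ordinal P0) => //; rewrite mem_index_enum.
by rewrite -lte_fin fineK.
Qed.

Lemma up_log_le_ln (R : realType) (N : nat) : (2 <= N)%N ->
  (up_log 2 N).+1%:R <= 3 / ln 2 * ln N%:R :> R.
Proof.
move=> N2; have l2 : 0 < ln 2 :> R by rewrite ln_gt0// ltr1n.
have lN : ln 2 <= ln N%:R :> R by rewrite ler_ln ?posrE ?ltr0n ?(ltnW N2)// ler_nat.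
have [n nE] : exists n, up_log 2 N = n.+1.
  by exists (up_log 2 N).-1; rewrite prednK ?up_log_gt0.
have h : (2 ^ n <= N)%N.
  by have := up_log_bounds (ltnSn 1) N2; rewrite nE /= => /andP[/ltnW].
have h2 : n%:R * ln 2 <= ln N%:R :> R.
  rewrite mulrC mulr_natr -lnXn// -natrX ler_ln ?posrE ?ltr0n ?expn_gt0// ?(ltnW N2)//.
  by rewrite ler_nat.
by rewrite nE mulrAC ler_pdivlMr// -[n.+2%:R]natr1 -[n.+1%:R]natr1 !mulrDl !mul1r; lra.
Qed.

Theorem corollary1p4 (R : realType) (d : nat) (beta : R) (psi : R -> R) :
  (3 <= d)%N ->
  2 / (d%:R - 1) <= beta ->
  exp_young_function beta psi ->
  exists C : R, 0 < C /\
    forall N : nat, (2 <= N)%N ->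
    exists P : {fset d.-tuple R},
      [/\ [set` P] `<=` unit_cube d,
          #|` P|%fset = N &
          (orlicz_norm psi (lebesgue_tuple d) (unit_cube d) (discrepancy P)
            <= (C * ln N%:R `^ ((d%:R - 1) - 1 / beta))%:E)%E].
Proof.
case: d => // s; rewrite ltnS (_ : s.+1%:R - 1 = s%:R); last by rewrite -natr1 addrK.
rewrite div1r => s2 sb psiP.
have s0 : (0 < s)%N by apply: leq_trans s2.
have sR : 0 < s%:R :> R by rewrite ltr0n.
have beta0 : 0 < beta by apply: lt_le_trans sb; rewrite divr_gt0.
have [A [A0 psiA]] := exp_young_le psiP; have [yp _] := psiP.
pose kappa : R := (32 * expR 1) `^ beta^-1.
pose B1 : R := (\prod_(i < s) sylvester i)%:R + s%:R + 1.
pose g := s%:R - beta^-1.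
have g0 : 0 <= g.
  rewrite subr_ge0 invf_ple ?posrE//; apply: le_trans sb.
  by rewrite -[leLHS]div1r ler_pM2r ?invr_gt0// ler1n.
have kappa0 : 0 < kappa by rewrite powR_gt0// mulr_gt0// expR_gt0.
have B10 : 0 < B1 by rewrite /B1 ltr_wpDl// addr_ge0.
have l2 : 0 < ln 2 :> R by rewrite ln_gt0// ltr1n.
have A2 : 0 < A + 2 by lra.
exists ((A + 2) * (kappa * B1 * (3 / ln 2) `^ g)); split.
  by rewrite !mulr_gt0// powR_gt0// divr_gt0.
move=> N N2; pose n := up_log 2 N.
have N0 : (0 < N)%N by exact: ltnW.
have Nn : (N <= 2 ^ n)%N by exact: up_logP.
pose P := (\prod_(i < s) sylvester i ^ n)%N.
have P0 : (0 < P)%N by apply: prodn_gt0 => i; rewrite expn_gt0 ltnW// sylvester_gt1.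
(* At scale K the average over the shifts of psi is at most A + 2, and
   [young_scale] turns this into 1 at scale (A + 2) K. *)
pose K := kappa * B1 * n.+1%:R `^ g.
have K0 : 0 < K by rewrite !mulr_gt0// powR_gt0.
pose D t := discrepancy (halton_set R s N n t).
pose H t x := (A + expR ((`|D t x| / K) `^ beta)) / (A + 2).
have H0 t x : 0 <= H t x by rewrite divr_ge0 ?(ltW A2)// addr_ge0// expR_ge0.
pose mu := @lebesgue_tuple R s.+1.
have mcube : measurable (unit_cube s.+1 : set (s.+1.-tuple (measurableTypeR R))).
  apply: (@measurable_tuple_box _ (measurableTypeR R) s.+1
    (fun=> `[0%R, 1%R[%classic)) => i.
  exact: measurable_itv.
have mH t : measurable_fun (unit_cube s.+1 : set (s.+1.-tuple (measurableTypeR R)))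
    (fun x => (H t x)%:E).
  apply: measurable_funTS; apply/measurable_EFinP.
  apply: measurable_funM; last exact: measurable_cst.
  apply: measurable_funD; first exact: measurable_cst.
  apply: (measurableT_comp (@measurable_expR R)).
  apply: (measurableT_comp (@measurable_powR R beta)).
  apply: measurable_funM; last exact: measurable_cst.
  apply: (measurableT_comp (@normr_measurable R setT)) => //.
  exact: measurable_discrepancy.
have [t Ht] : exists t, (\int[mu]_(x in unit_cube s.+1) (H t x)%:E <= 1)%E.
  apply: (ereal_average_le P0) => [t|].
    by apply: integral_ge0 => x _; rewrite lee_fin.
  rewrite -(@ge0_integral_sum _ _ _ mu _ mcube _
    (fun (t : 'I_P) x => (H t x)%:E)) => [|t|t x _] //; last by rewrite lee_fin.
  apply: (@le_trans _ _ (\int[mu]_(x in unit_cube s.+1) (cst P%:R%:E) x)%E).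
    apply: ge0_integral_mono => x xc; first by apply: sume_ge0 => t _; rewrite lee_fin.
    rewrite sumEFin lee_fin /H -mulr_suml ler_pdivrMr//.
    rewrite big_split /= sumr_const card_ord -[A *+ P]mulr_natl [leRHS]mulrDr lerD2l.
    exact: discrepancy_exp_bound.
  rewrite integral_cst// [X in (_ * X)%E](_ : _ = 1%E) ?mule1//.
  exact: lebesgue_tuple_unit_cube.
exists (halton_set R s N n t); split.
- exact: halton_set_cube.
- exact: card_halton_set.
apply: (@le_trans _ _ ((A + 2) * K)%:E).
  apply: ereal_inf_lbound; exists ((A + 2) * K) => //; split; first exact: mulr_gt0.
  apply: le_trans Ht; apply: ge0_integral_mono => x _; rewrite lee_fin.
    by case: yp => + _ _; apply; rewrite divr_ge0// ltW// mulr_gt0.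
  have D0 : 0 <= `|D t x| / K by rewrite divr_ge0// ltW.
  have A21 : 1 <= A + 2 by lra.
  have := young_scale yp D0 A21.
  rewrite -mulrA -invfM [K * _]mulrC => /le_trans; apply.
  by rewrite ler_pM2r ?invr_gt0// psiA.
rewrite lee_fin -mulrA ler_pM2l// /K -!mulrA !ler_pM2l//.
have lN0 : 0 <= ln N%:R :> R by rewrite ln_ge0// ler1n.
have c0 : 0 <= 3 / ln 2 :> R by rewrite divr_ge0// ltW.
rewrite -powRM//; apply: ge0_ler_powR => //; rewrite ?nnegrE //; first exact: mulr_ge0.
exact: up_log_le_ln.
Qed.
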